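(* Let $w=(w_k)_{k\ge0}$ be a weight sequence with $w_0>0$, $w_k>0$ for all large $k$, and $w_{k+1}/w_k\to0$ as $k\to\infty$. Suppose that $n\to\infty$ and $m=m(n)$ with $m=\lambda n+o(\sqrt n)$, where $0<\lambda<\infty$. Let $\tau>0$ satisfy $\Psi(\tau)=\lambda$, let $\pi_k=\tau^kw_k/\Phi(\tau)$ and $n_k=\lfloor1/\pi_k\rfloor$. (i) Consider $n$ in a subsequence such that for some $k(n)$ and some $x\in(0,\infty)$, $n/n_{k(n)}\to x$. Then $P(Y_{(1)}=k(n)-1)\to e^{-x}$ and $P(Y_{(1)}=k(n))\to1-e^{-x}$. (ii) Let $\Omega_k\to\infty$ as $k\to\infty$. If $n\to\infty$ with $n\notin\bigcup_{k\ge1}[\Omega_k^{-1}n_k,\Omega_kn_k]$, then, for $k(n)$ such that $n_{k(n)}<n<n_{k(n)+1}$, $P(Y_{(1)}=k(n))\to1$.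
   Context: A weight sequence is a sequence $w=(w_k)_{k\ge0}$ of nonnegative reals. $\Phi(t)=\sum_kw_kt^k$ (here entire), $\Psi(t)=t\Phi'(t)/\Phi(t)$. Balls-in-boxes: $\mathcal B_{m,n}=\{(y_1,\dots,y_n)\in\{0,1,\dots\}^n:\sum y_i=m\}$, weight $w(y)=\prod_iw_{y_i}$, $Z(m,n)=\sum_{y\in\mathcal B_{m,n}}w(y)$; when $Z(m,n)>0$, $B_{m,n}=(Y_1,\dots,Y_n)$ is random with $P(B_{m,n}=y)=w(y)/Z(m,n)$. $Y_{(1)}=\max_iY_i$. *)

(* Defs.v *)
From HB Require Import structures.
From mathcomp Require Import all_boot all_order all_algebra.
From mathcomp Require Import all_classical all_reals all_analysis.
Set Implicit Arguments. Unset Strict Implicit. Unset Printing Implicit Defensive.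
Import Order.TTheory GRing.Theory Num.Theory numFieldNormedType.Exports.
Local Open Scope ring_scope.

Section BB.
Variable R : realType.

Definition Phi (w : nat -> R) (t : R) : R :=
  limn (fun n : nat => (\sum_(0 <= k < n) (w k * t ^+ k) : R)).

Definition Psi (w : nat -> R) (t : R) : R :=
  t * derive1 (Phi w) t / Phi w t.

(* balls-in-boxes configurations y in B_{m,n}: y : 'I_n -> {0..m}, sum y_i = m *)
Definition inB (m n : nat) (y : {ffun 'I_n -> 'I_m.+1}) : bool :=
  (\sum_(i < n) (y i : nat))%N == m.

Definition wgt (w : nat -> R) (m n : nat) (y : {ffun 'I_n -> 'I_m.+1}) : R :=
  \prod_(i < n) w (y i).

Definition Zmn (w : nat -> R) (m n : nat) : R :=
  \sum_(y : {ffun 'I_n -> 'I_m.+1} | inB y) wgt w y.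

Definition Ymax (m n : nat) (y : {ffun 'I_n -> 'I_m.+1}) : nat :=
  (\max_(i < n) (y i : nat))%N.

Definition PYmax (w : nat -> R) (m n k : nat) : R :=
  \sum_(y : {ffun 'I_n -> 'I_m.+1} | inB y && (Ymax y == k)) (wgt w y / Zmn w m n).

Definition pik (w : nat -> R) (tau : R) (k : nat) : R :=
  tau ^+ k * w k / Phi w tau.

Definition nk (w : nat -> R) (tau : R) (k : nat) : R :=
  (Num.floor (1 / pik w tau k))%:~R.

End BB.

(* Main.v *)
(** The boxes are an i.i.d. sample of pi conditioned on its sum, so everything is
    expressed through the coefficients f(n, m) of X^m in A^n, where A is the
    generating polynomial of pi truncated at a large degree L(n): expectations of
    factorial moments are ratios of such coefficients, and all that is needed is
    f(n - r, m - j) / f(n, m) -> 1 for j = o(n^(3/8)).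

    No local limit theorem is used for this.  Under the unconditioned law the
    number N_a of boxes with a balls has exponentially small deviations, and the
    mean of N_a restricted to the event of total m is n pi_a f(n - 1, m - a).
    Hence f(n - 1, m - a) and f(n, m) agree up to a factor 1 + O(D^-3) and an error
    exp(-D^2 / 2), D = n^(1/8).  Using a = 0, K, K + 1 one may change n and m
    one unit at a time.  Chebyshev's inequality gives some l within O(sqrt n) of
    lambda n with f(n, l) >= c / n, and moving from l to m costs at most a factor
    exp(-O(D)), so f(n, m) is much larger than the additive error.

    Then the first moment of the number of boxes with more than k balls, the second
    moment of the number with exactly k balls when n pi_k -> oo, and all factorial
    moments of the latter when n pi_k -> x, give the law of the maximum. *)

Require Import Defs.
From HB Require Import structures.
From mathcomp Require Import all_boot all_order all_algebra.
From mathcomp Require Import all_classical all_reals all_analysis.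
From mathcomp Require Import ring lra zify.
Set Implicit Arguments. Unset Strict Implicit. Unset Printing Implicit Defensive.
Import Order.TTheory GRing.Theory Num.Theory numFieldNormedType.Exports.
Local Open Scope classical_set_scope.
Local Open Scope ring_scope.

(** * Polynomials with nonnegative coefficients *)

Lemma bin_trinomial_revision n j r : (r <= j <= n)%N ->
  ('C(n, j) * 'C(j, r))%N = ('C(n, r) * 'C(n - r, j - r))%N.
Proof.
case/andP=> rj jn; have rn := leq_trans rj jn.
have := bin_fact jn; have := bin_fact rj; have := bin_fact rn.
have jrnr : (j - r <= n - r)%N by apply: leq_sub2r.
have := bin_fact jrnr; rewrite (_ : n - r - (j - r) = n - j)%N; last lia.
move=> e1 e2 e3 e4.
apply/eqP; rewrite -(@eqn_pmul2r (r`! * (j - r)`! * (n - j)`!)); last first.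
  by rewrite !muln_gt0 !fact_gt0.
apply/eqP; transitivity (n`!)%N.
  rewrite -e4 -e3; ring.
rewrite -e2 -e1; ring.
Qed.

(** Trinomial revision moves C(n, r) out of the sum and leaves the binomial expansion of (Q + B)^(n
    - r). With B a marked monomial of a generating polynomial, this is the r-th binomial moment of
    the number of boxes that use it. *)
Lemma sum_bin_moment (S : comNzRingType) (Q B : S) n r :
  \sum_(j < n.+1) (Q ^+ (n - j) * B ^+ j) *+ 'C(n, j) *+ 'C(j, r) =
  (B ^+ r * (Q + B) ^+ (n - r)) *+ 'C(n, r).
Proof.
have [rn|nr] := leqP r n; last first.
  rewrite [in RHS]bin_small // mulr0n big1 // => j _.
  by rewrite (@bin_small j) ?mulr0n //; have := ltn_ord j; lia.
rewrite -(big_mkord xpredT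
  (fun j => (Q ^+ (n - j) * B ^+ j) *+ 'C(n, j) *+ 'C(j, r))).
rewrite (big_cat_nat (n := r)) //=; last lia.
rewrite big_nat_cond big1 ?add0r; last first.
  by move=> j /andP[/andP[_ jr] _]; rewrite (@bin_small j).
rewrite -{1}(add0n r) big_addn exprDn mulr_sumr -sumrMnl subSn // big_mkord.
apply: eq_bigr => i _.
rewrite mulrnAr -!mulrnA bin_trinomial_revision; last first.
  by have := ltn_ord i; lia.
rewrite addnK mulnC; congr (_ *+ _).
by rewrite mulrCA -exprD (addnC r) subnDA [X in Q ^+ X]subnAC.
Qed.

Section NonnegPoly.
Variable R : realFieldType.
Implicit Types p q u : {poly R}.

Definition ge0p p := forall i, 0 <= p`_i.

Lemma ge0pD p q : ge0p p -> ge0p q -> ge0p (p + q).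
Proof. by move=> hp hq i; rewrite coefD addr_ge0. Qed.

Lemma ge0pM p q : ge0p p -> ge0p q -> ge0p (p * q).
Proof. by move=> hp hq i; rewrite coefM sumr_ge0 // => j _; rewrite mulr_ge0. Qed.

Lemma ge0p0 : ge0p 0. Proof. by move=> i; rewrite coef0. Qed.
Lemma ge0p1 : ge0p 1. Proof. by move=> i; rewrite coef1; case: eqP. Qed.

Lemma ge0pX p n : ge0p p -> ge0p (p ^+ n).
Proof.
move=> hp; elim: n => [|n IH]; first by rewrite expr0; apply: ge0p1.
by rewrite exprS; apply: ge0pM.
Qed.

Lemma ge0pMn p n : ge0p p -> ge0p (p *+ n).
Proof. by move=> hp i; rewrite coefMn mulrn_wge0. Qed.

Lemma ge0p_sum (I : Type) (s : seq I) (P : pred I) (F : I -> {poly R}) :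
  (forall i, P i -> ge0p (F i)) -> ge0p (\sum_(i <- s | P i) F i).
Proof.
by move=> hF; elim/big_ind: _ => //; [exact: ge0p0|exact: ge0pD].
Qed.

Lemma ge0p_monom a c : 0 <= c -> ge0p (c *: 'X^a).
Proof. by move=> hc i; rewrite coefZ coefXn; case: eqP; rewrite ?mulr1 ?mulr0. Qed.

Lemma coef_le_horner1 p i : ge0p p -> p`_i <= p.[1].
Proof.
move=> hp; rewrite horner_coef.
under eq_bigr do rewrite expr1n mulr1.
have [hi|hi] := ltnP i (size p); last first.
  by rewrite nth_default // sumr_ge0 // => j _.
by rewrite (bigD1 (Ordinal hi)) //= lerDl sumr_ge0.
Qed.

Lemma ge0p_expB p q n : ge0p p -> ge0p (q - p) -> ge0p (q ^+ n - p ^+ n).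
Proof.
move=> hp hqp; rewrite subrXX; apply: ge0pM => //.
have hq : ge0p q by rewrite -(subrK p q); apply: ge0pD.
by apply: ge0p_sum => i _; apply: ge0pM; apply: ge0pX.
Qed.

(** Union bound in coefficient form: a term of q^n missing from p^n uses q - p in at least one of
    the n factors. In the factorisation of q^n - p^n each p^i is replaced by q^i. *)
Lemma ge0p_expB_le p q n : ge0p p -> ge0p (q - p) ->
  ge0p (((q - p) * q ^+ n.-1) *+ n - (q ^+ n - p ^+ n)).
Proof.
move=> hp hqp; have hq : ge0p q by rewrite -(subrK p q); apply: ge0pD.
have -> : ((q - p) * q ^+ n.-1) *+ n = (q - p) * \sum_(i < n) q ^+ n.-1.
  by rewrite sumr_const card_ord mulrnAr.
rewrite subrXX -mulrBr -sumrB; apply: ge0pM => //; apply: ge0p_sum => i _.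
have {1}-> : n.-1 = (n.-1 - i + i)%N by have := ltn_ord i; lia.
rewrite exprD -mulrBr; apply: ge0pM; first exact: ge0pX.
exact: ge0p_expB.
Qed.

(* The weight that A ^+ n gives at X^m to the terms where the monomial
   [c *: 'X^a] of A was chosen exactly j times. *)
Definition occ (A : {poly R}) (c : R) (a n m j : nat) : R :=
  (((A - c *: 'X^a) ^+ (n - j) * (c *: 'X^a) ^+ j) *+ 'C(n, j))`_m.

Lemma occ_ge0 A c a n m j : 0 <= c -> ge0p (A - c *: 'X^a) ->
  0 <= occ A c a n m j.
Proof.
move=> hc hA; apply: ge0pMn; apply: ge0pM; apply: ge0pX => //.
exact: ge0p_monom.
Qed.

Lemma sum_occ_bin A c a n m r :
  \sum_(j < n.+1) occ A c a n m j *+ 'C(j, r) =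
  c ^+ r *+ 'C(n, r) * ('X^(a * r) * A ^+ (n - r))`_m.
Proof.
have /(congr1 (fun p : {poly R} => p`_m)) :=
  sum_bin_moment (A - c *: 'X^a) (c *: 'X^a) n r.
rewrite coef_sum subrK => e; rewrite mulrnAl.
transitivity (((c *: 'X^a) ^+ r * A ^+ (n - r) *+ 'C(n, r))`_m).
  by rewrite -e; apply: eq_bigr => j _; rewrite coefMn.
by rewrite coefMn exprZn -exprM -scalerAl coefZ.
Qed.

Lemma sum_occ A c a n m : \sum_(j < n.+1) occ A c a n m j = (A ^+ n)`_m.
Proof.
have := sum_occ_bin A c a n m 0.
rewrite bin0 expr0 mulr1n mul1r muln0 expr0 mul1r subn0 => <-.
by apply: eq_bigr => j _; rewrite bin0.
Qed.

Lemma sum_occ_exp A c a n m z :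
  \sum_(j < n.+1) occ A c a n m j * z ^+ j =
  ((A - c *: 'X^a + (z * c) *: 'X^a) ^+ n)`_m.
Proof.
rewrite exprDn coef_sum; apply: eq_bigr => j _.
by rewrite -scalerA exprZn -scalerAr scalerMnr coefZ mulrC.
Qed.

Lemma occ0 A c a n m : occ A c a n m 0 = ((A - c *: 'X^a) ^+ n)`_m.
Proof. by rewrite /occ bin0 mulr1n expr0 mulr1 subn0. Qed.

End NonnegPoly.

(** * One step: changing the number of boxes and balls together *)

Section Step.
Variable R : realType.
Implicit Types A : {poly R}.

(** From e^(-s) >= 1 - s follows (1 - s) e^s <= 1, and (1 - s)(1 + s + 2 s^2) = 1 + s^2 (1 - 2 s) >=
    1 for s <= 1/2. *)
Lemma expR_le_quadratic (s : R) : `|s| <= 1 / 2 -> expR s <= 1 + s + 2 * s ^+ 2.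
Proof.
rewrite ler_norml => /andP[s1 s2].
have h := expR_ge1Dx (- s); rewrite expRN in h.
have e0 := expR_gt0 s.
have h2 : (1 - s) * expR s <= 1.
  by rewrite -(@ler_pM2r _ (expR s)) // mulVf ?gt_eqF // in h.
have h3 : 1 <= (1 - s) * (1 + s + 2 * s ^+ 2).
  have -> : (1 - s) * (1 + s + 2 * s ^+ 2) = 1 + s ^+ 2 * (1 - 2 * s) by ring.
  by rewrite lerDl mulr_ge0 ?sqr_ge0 //; lra.
rewrite -(@ler_pM2l _ (1 - s)); last lra.
exact: le_trans h2 h3.
Qed.

(* Exponential tilting of the number j of factors equal to p X^a, linearised by
   v <= e^v with v = s (j - n p) - 3 n s^2. *)
Lemma tilt_bound A (p s : R) a n m :
  (0 < n)%N -> 0 < p <= 1 -> ge0p (A - p *: 'X^a) -> A.[1] <= 1 ->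
  `|s| <= 1 / 2 ->
  p * n%:R * s * (('X^a * A ^+ n.-1)`_m - (A ^+ n)`_m) <=
  3 * (n%:R * s ^+ 2) * (A ^+ n)`_m + expR (- (n%:R * s ^+ 2)).
Proof.
move=> n0 /andP[p0 p1] hA A1 hs.
set T := n%:R * s ^+ 2.
pose q := occ A p a n m.
have q0 j : 0 <= q j by apply: occ_ge0 => //; apply: ltW.
have e0 : \sum_(j < n.+1) q j = (A ^+ n)`_m := sum_occ A p a n m.
have e1 : \sum_(j < n.+1) q j * j%:R = p * n%:R * ('X^a * A ^+ n.-1)`_m.
  have := sum_occ_bin A p a n m 1.
  rewrite muln1 subn1 bin1 expr1 -mulr_natr => <-.
  by apply: eq_bigr => j _; rewrite bin1 mulr_natr.
have e2 : \sum_(j < n.+1) q j * expR s ^+ j <= expR (n%:R * p * (s + 2 * s ^+ 2)).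
  rewrite /q sum_occ_exp.
  have g : ge0p (A - p *: 'X^a + (expR s * p) *: 'X^a).
    apply: ge0pD => //; apply: ge0p_monom.
    by rewrite mulr_ge0 ?expR_ge0 // ltW.
  apply: le_trans (coef_le_horner1 _ (ge0pX _ g)) _.
  rewrite horner_exp -mulrA expRM_natl.
  rewrite lerXn2r ?nnegrE ?expR_ge0 //.
    rewrite horner_coef sumr_ge0 // => i _.
    by rewrite expr1n mulr1.
  rewrite !hornerD hornerN !hornerZ !hornerXn !expr1n !mulr1.
  apply: le_trans _ (expR_ge1Dx _).
  have h := expR_le_quadratic hs.
  have : p * (expR s - 1) <= p * (s + 2 * s ^+ 2).
    by rewrite ler_pM2l //; lra.
  lra.
have e3 j : s * (j%:R - n%:R * p) <= 3 * T + expR s ^+ j * expR (- (n%:R * p * s) - 3 * T).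
  rewrite -expRM_natl -expRD.
  have := expR_ge1Dx (j%:R * s + (- (n%:R * p * s) - 3 * T)).
  lra.
have e4 : \sum_(j < n.+1) q j * (s * (j%:R - n%:R * p)) <=
   \sum_(j < n.+1) (q j * (3 * T) + q j * expR s ^+ j * expR (- (n%:R * p * s) - 3 * T)).
  apply: ler_sum => j _; rewrite -mulrA -mulrDr.
  by apply: ler_wpM2l.
move: e4; rewrite big_split /= -!mulr_suml e0.
have -> : \sum_(j < n.+1) q j * (s * (j%:R - n%:R * p)) =
   p * n%:R * s * (('X^a * A ^+ n.-1)`_m - (A ^+ n)`_m).
  transitivity (s * (\sum_(j < n.+1) q j * j%:R) - s * (n%:R * p) * \sum_(j < n.+1) q j).
    by rewrite !mulr_sumr -sumrB; apply: eq_bigr => j _; ring.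
  by rewrite e0 e1; ring.
move=> e4; apply: le_trans e4 _.
rewrite [3 * T * _]mulrC lerD2l.
apply: le_trans (ler_wpM2r (expR_ge0 _) e2) _.
rewrite -expRD ler_expR /T.
have : n%:R * s ^+ 2 * p <= n%:R * s ^+ 2.
  by rewrite ler_piMr // mulr_ge0 ?sqr_ge0.
lra.
Qed.

(** [tilt_bound] at s and at -s controls both signs of the difference; dividing by n s, which is at
    least 1, only shrinks the exponential term. *)
Lemma step_bound A (p s : R) a n m :
  (0 < n)%N -> 0 < p <= 1 -> ge0p (A - p *: 'X^a) -> A.[1] <= 1 ->
  0 < s <= 1 / 2 -> 1 <= n%:R * s ->
  p * `|('X^a * A ^+ n.-1)`_m - (A ^+ n)`_m| <=
  3 * s * (A ^+ n)`_m + expR (- (n%:R * s ^+ 2)).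
Proof.
move=> n0 hp hA A1 /andP[s0 s1] ns.
set f := (A ^+ n)`_m; set g := ('X^a * _)`_m.
have key t : `|t| = s -> p * (t / s) * (g - f) <= 3 * s * f + expR (- (n%:R * s ^+ 2)).
  move=> ht; have t2 : t ^+ 2 = s ^+ 2 by rewrite -ht real_normK ?num_real.
  have := @tilt_bound A p t a n m n0 hp hA A1; rewrite ht => /(_ s1).
  rewrite t2 -/f -/g => h.
  have ns0 : 0 < n%:R * s by lra.
  rewrite -(ler_pM2l ns0).
  have -> : n%:R * s * (p * (t / s) * (g - f)) = p * n%:R * t * (g - f).
    by field; rewrite gt_eqF.
  apply: le_trans h _.
  rewrite [n%:R * s * _]mulrDr; apply: lerD; first by rewrite le_eqVlt; apply/orP; left; apply/eqP; ring.
  by rewrite ler_peMl ?expR_ge0.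
have k1 := key s (gtr0_norm s0).
have k2 := key (- s); rewrite normrN gtr0_norm // in k2; have {}k2 := k2 erefl.
rewrite mulNr !divff ?gt_eqF // in k1 k2.
have [d|d] := leP 0 (g - f); first by rewrite ger0_norm //; lra.
by rewrite ltr0_norm //; lra.
Qed.

End Step.

(** * Smoothness of the coefficients of powers *)

Section Near.
Variable R : realType.
Implicit Types t u v x : R.

(** Closeness is measured by the exponent of the ratio, so that it is symmetric and adds up along a
    chain of steps. *)
Definition near_ratio t u v := u <= expR t * v /\ v <= expR t * u.

Lemma near_ratio_refl u : near_ratio 0 u u.
Proof. by rewrite /near_ratio expR0 mul1r. Qed.

Lemma near_ratio_sym t u v : near_ratio t u v -> near_ratio t v u.
Proof. by case. Qed.

Lemma near_ratio_trans t t' u v x :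
  near_ratio t u v -> near_ratio t' v x -> near_ratio (t + t') u x.
Proof.
move=> [h1 h2] [h3 h4]; split; rewrite expRD.
  by apply: le_trans h1 _; rewrite -mulrA ler_wpM2l ?expR_ge0.
by apply: le_trans h4 _; rewrite [expR t * _]mulrC -mulrA ler_wpM2l ?expR_ge0.
Qed.

Lemma near_ratio_step d u v : 0 <= d <= 1 / 2 -> 0 <= u ->
  `|v - u| <= d * u -> near_ratio (2 * d) u v.
Proof.
move=> /andP[d0 d1] u0; rewrite ler_norml => /andP[h1 h2].
have e := expR_ge1Dx (2 * d).
have v0 : 0 <= v by nra.
split; last by nra.
have h : (1 + 2 * d) * v <= expR (2 * d) * v by rewrite ler_wpM2r.
nra.
Qed.

Lemma near_ratio_dist t u v : 0 <= t -> 0 <= v -> near_ratio t u v ->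
  `|u - v| <= (expR t - 1) * v.
Proof.
move=> t0 v0 [h1 h2]; have e := expR_ge1Dx t; rewrite ler_norml; apply/andP; split.
  have e1 : 1 <= expR t by lra.
  have : expR t * ((expR t - 1) * v) >= (expR t - 1) * v.
    by rewrite ler_peMl // mulr_ge0 // subr_ge0.
  nra.
lra.
Qed.

Lemma near_ratio_le t t' u v : 0 <= u -> 0 <= v -> t <= t' ->
  near_ratio t u v -> near_ratio t' u v.
Proof.
move=> u0 v0 tt [h1 h2]; split.
  by apply: le_trans h1 _; rewrite ler_wpM2r // ler_expR.
by apply: le_trans h2 _; rewrite ler_wpM2r // ler_expR.
Qed.

End Near.

Section Chain.
Variable R : realType.
Variables (A : {poly R}) (K : nat) (p0 D : R).
Hypothesis A0 : ge0p A.
Hypothesis A1 : A.[1] <= 1.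
Hypothesis p0_gt0 : 0 < p0.
Hypothesis AK : forall a, a \in [:: 0; K; K.+1]%N -> p0 <= A`_a.
Hypothesis D2 : 2 <= D.
Hypothesis Dp : 6 / p0 <= D.

Let eps := D ^+ 3 * expR (- (D ^+ 2 / 2)).
(* Adding eps makes the additive error of [step_bound] multiplicative; the factor
   'X^K makes the steps a <= K available at every exponent of A ^+ n. *)
Definition shifted_coef n i := ('X^K * A ^+ n)`_i + eps.
Let ft := shifted_coef.
Let c := 6 / p0.

Let D_gt0 : 0 < D. Proof. exact: lt_le_trans D2. Qed.

Lemma eps_gt0 : 0 < eps.
Proof. apply: mulr_gt0; [exact: exprn_gt0|exact: expR_gt0]. Qed.

Lemma ge0p_sub_monom a : ge0p (A - A`_a *: 'X^a).
Proof.
move=> i; rewrite coefB coefZ coefXn.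
by case: eqP => [->|_]; rewrite ?mulr1 ?subrr // mulr0 subr0.
Qed.

Lemma shifted_coef_ge0 n i : 0 <= ft n i.
Proof.
apply: addr_ge0; last exact/ltW/eps_gt0.
by apply: ge0pM; [move=> j; rewrite coefXn; case: eqP|exact: ge0pX].
Qed.

(** This is [step_bound] with s = D^-3: since n >= D^8 / 2, its exponential term is at most exp(-D^2
    / 2) = s eps, so the whole error is at most a multiple of s (f + eps). Asking only for half of
    D^8 leaves room to remove up to half of the boxes. *)
Lemma near_box a n i : a \in [:: 0; K; K.+1]%N -> D ^+ 8 / 2 <= n%:R ->
  (a <= i)%N -> near_ratio (c / D ^+ 3) (ft n.-1 (i - a)) (ft n i).
Proof.
move=> ha hn ai; apply: near_ratio_sym.
have hD2 := D2; have hp0 := p0_gt0; have D0 := D_gt0.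
have D3 : 0 < D ^+ 3 by rewrite exprn_gt0.
have pa := AK ha.
have pa1 : A`_a <= 1 by apply: le_trans A1; exact: coef_le_horner1.
have n0 : (0 < n)%N.
  by rewrite -(ltr_nat R); apply: lt_le_trans hn; rewrite divr_gt0 ?exprn_gt0.
have -> : c / D ^+ 3 = 2 * (3 / p0 / D ^+ 3) by rewrite /c; field; rewrite !gt_eqF.
have D1 n' : 1 <= D ^+ n' by rewrite exprn_ege1 //; lra.
apply: near_ratio_step.
- apply/andP; split; first by rewrite !divr_ge0 // ltW.
  rewrite ler_pdivrMr //.
  have h : 6 / p0 <= D ^+ 3.
    by apply: le_trans Dp _; rewrite exprSr ler_peMl // ltW.
  lra.
- exact: shifted_coef_ge0.
rewrite /ft /shifted_coef opprD addrACA subrr addr0.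
have e0 := eps_gt0.
have [iK|Ki] := ltnP i K.
  rewrite !coefXnM iK (leq_ltn_trans (leq_subr _ _) iK).
  by rewrite subrr normr0 add0r mulr_ge0 ?ltW // !divr_gt0.
rewrite !coefXnM (ltnNge i) Ki /=.
have -> : (if (i - a < K)%N then 0 else (A ^+ n.-1)`_(i - a - K)) =
   ('X^a * A ^+ n.-1)`_(i - K).
  rewrite coefXnM (_ : (i - a < K) = (i - K < a))%N.
    by case: ifP => // _; rewrite subnAC.
  by clear -ai Ki; lia.
set f := (A ^+ n)`__.
have f0 : 0 <= f by apply: ge0pX.
have hs : 0 < (D ^+ 3)^-1 <= 1 / 2.
  rewrite invr_gt0 D3 /= mul1r lef_pV2 ?posrE //.
  apply: le_trans D2 _; rewrite exprSr ler_peMl //; lra.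
have hn5 : 1 <= n%:R * (D ^+ 3)^-1.
  rewrite ler_pdivlMr // mul1r; apply: le_trans hn.
  have -> : D ^+ 8 = D ^+ 3 * (D * D ^+ 4) by ring.
  rewrite -mulrA ler_pMr // ler_pdivlMr // mul1r.
  by apply: le_trans D2 _; rewrite ler_peMr // ltW.
have hp : 0 < A`_a <= 1 by rewrite pa1 andbT; exact: lt_le_trans pa.
have := @step_bound R A A`_a (D ^+ 3)^-1 a n (i - K) n0 hp (@ge0p_sub_monom a) A1 hs hn5.
rewrite -/f; set d := `| _ |; move=> h.
rewrite -(ler_pM2l p0_gt0).
apply: (@le_trans _ _ (A`_a * d)); first by rewrite ler_wpM2r ?normr_ge0.
apply: le_trans h _.
have -> : p0 * (3 / p0 / D ^+ 3 * (f + eps)) =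
   3 * (D ^+ 3)^-1 * f + 3 * expR (- (D ^+ 2 / 2)).
  by rewrite /eps; field; rewrite !gt_eqF.
rewrite lerD2l.
apply: (@le_trans _ _ (expR (- (D ^+ 2 / 2)))).
  rewrite ler_expR lerN2 exprVn -exprM ler_pdivlMr ?exprn_gt0 //.
  by rewrite mulrAC -exprD.
by rewrite ler_peMl ?expR_ge0 //; lra.
Qed.

(** Removing a box with K balls and then adding one with K + 1 balls raises the total by one at
    fixed n; this is where two consecutive weights come in. *)
Lemma near_succ n i : D ^+ 8 / 2 <= n%:R -> (K <= i)%N ->
  near_ratio (c / D ^+ 3 * 2) (ft n i) (ft n i.+1).
Proof.
move=> hn Ki; rewrite mulr2n mulrDr mulr1.
apply: (@near_ratio_trans _ _ _ _ (ft n.-1 (i - K))).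
  by apply: near_ratio_sym; apply: near_box => //; rewrite !inE eqxx orbT.
rewrite -subSS; apply: near_box => //; by rewrite !inE eqxx !orbT.
Qed.

Lemma near_addn n i j : D ^+ 8 / 2 <= n%:R -> (K <= i)%N ->
  near_ratio (c / D ^+ 3 * (2 * j%:R)) (ft n i) (ft n (i + j)).
Proof.
move=> hn Ki; elim: j => [|j IH].
  by rewrite !mulr0 addn0; apply: near_ratio_refl.
rewrite -(natr1 j) mulrDr mulr1 mulrDr addnS.
by apply: near_ratio_trans IH _; apply: near_succ => //; lia.
Qed.

Lemma near_subn_boxes n r i : (r <= n)%N -> D ^+ 8 / 2 <= (n - r)%:R ->
  near_ratio (c / D ^+ 3 * r%:R) (ft (n - r) i) (ft n i).
Proof.
elim: r => [|r IH] rn hn.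
  by rewrite mulr0 subn0; apply: near_ratio_refl.
have hn' : D ^+ 8 / 2 <= (n - r)%:R.
  by apply: le_trans hn _; rewrite ler_nat; lia.
rewrite -natr1 mulrDr mulr1 addrC subnS.
apply: near_ratio_trans (IH _ hn'); last lia.
by rewrite -{1}(subn0 i); apply: near_box.
Qed.

Lemma near_coef n r m j : (r <= n)%N -> D ^+ 8 / 2 <= (n - r)%:R -> (j <= m)%N ->
  near_ratio (c / D ^+ 3 * (r%:R + 2 * j%:R))
    ((A ^+ (n - r))`_(m - j) + eps) ((A ^+ n)`_m + eps).
Proof.
move=> rn hn jm.
have E n' i : (A ^+ n')`_i + eps = ft n' (K + i).
  by rewrite /ft /shifted_coef coefXnM ltnNge leq_addr /= addKn.
rewrite !E mulrDr; apply: near_ratio_trans.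
  exact: near_subn_boxes.
rewrite (_ : (K + m = K + (m - j) + j)%N); last lia.
apply: near_addn; last lia.
by apply: le_trans hn _; rewrite ler_nat; lia.
Qed.

End Chain.

(** The coefficient at m is reached from the one at l by at most C1 D^4 unit moves, each of cost
    O(D^-3), so it loses a factor e^(-O(D)). It still dwarfs eps, which is exp(-D^2 / 2) up to a
    power of D, so eps is absorbed into the coefficient itself at the price of the factor 2. *)
Lemma coef_power_smooth (R : realType) (K : nat) (p0 C1 c1 : R) :
  0 < p0 -> 0 < C1 -> 0 < c1 ->
  exists D1 c : R, [/\ 0 < c, 2 <= D1 &
   forall (A : {poly R}) (D : R) (n m l : nat),
    ge0p A -> A.[1] <= 1 -> (forall a, a \in [:: 0; K; K.+1]%N -> p0 <= A`_a) ->
    D1 <= D -> n%:R = D ^+ 8 ->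
    `|l%:R - m%:R| <= C1 * D ^+ 4 -> c1 / D ^+ 8 <= (A ^+ n)`_l ->
    0 < (A ^+ n)`_m /\
    forall r j, (2 * r <= n)%N -> (j <= m)%N ->
     `|(A ^+ (n - r))`_(m - j) - (A ^+ n)`_m| <=
        2 * (expR (c * (r + j)%:R / D ^+ 3) - 1) * (A ^+ n)`_m].
Proof.
move=> p00 C10 c10; set c := 6 / p0; have c0 : 0 < c by rewrite divr_gt0.
(* In the bound on D, 12 pays for a power D^12, 2 c C1 for the walk from l to m and 1 / c1 for the
   constant c1; the 2 in front of them comes from comparing with D^2 / 2. The summand c gives 6 / p0
   <= D. *)
exists (2 + c + 2 * (12 + 2 * c * C1 + 1 / c1)), (2 * c); split.
- by rewrite mulr_gt0.
- have : 0 < 2 * c * C1 by apply: mulr_gt0 => //; apply: mulr_gt0.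
  have : 0 < 1 / c1 by apply: divr_gt0.
  lra.
move=> A D n m l A0 A1 AK hD nD lm hl.
have cC : 0 < 2 * c * C1 by apply: mulr_gt0 => //; apply: mulr_gt0.
have ic : 0 < 1 / c1 by apply: divr_gt0.
have D2 : 2 <= D by lra.
have Dc : 6 / p0 <= D by rewrite -/c; lra.
have D0 : 0 < D by lra.
pose eps := D ^+ 3 * expR (- (D ^+ 2 / 2)).
have e0 : 0 < eps := eps_gt0 D2.
have near := @near_coef R A K p0 D A0 A1 p00 AK D2 Dc.
have f0 n' i : 0 <= (A ^+ n')`_i by apply: ge0pX.
have hn : D ^+ 8 / 2 <= (n - 0)%:R by rewrite subn0 nD; have := exprn_gt0 8 D0; lra.
have low : c1 / D ^+ 8 * expR (- (2 * c * C1 * D)) <= (A ^+ n)`_m + eps.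
  have [t ht [h1 h2]] : exists2 t, t <= 2 * c * C1 * D &
     near_ratio t ((A ^+ n)`_l + eps) ((A ^+ n)`_m + eps).
    have tle d : d <= C1 * D ^+ 4 -> c / D ^+ 3 * (0 + 2 * d) <= 2 * c * C1 * D.
      move=> hd; rewrite add0r mulrAC ler_pdivrMr ?exprn_gt0 //.
      have -> : 2 * c * C1 * D * D ^+ 3 = c * 2 * (C1 * D ^+ 4) by ring.
      by rewrite mulrA ler_pM2l // mulr_gt0.
    (* [near_coef] only lowers the exponent, so the walk starts at the larger of l and m. *)
    have [ml|lm'] := leqP l m.
      exists (c / D ^+ 3 * (0 + 2 * (m - l)%:R)).
        by apply: tle; rewrite natrB //; apply: le_trans lm; rewrite distrC ler_norm.
      have := @near n 0%N m (m - l)%N (leq0n _) hn (leq_subr _ _).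
      by rewrite subn0 subKn.
    exists (c / D ^+ 3 * (0 + 2 * (l - m)%:R)).
      by apply: tle; rewrite natrB 1?ltnW //; apply: le_trans lm; rewrite ler_norm.
    have := @near n 0%N l (l - m)%N (leq0n _) hn (leq_subr _ _).
    by rewrite subn0 subKn 1?ltnW // => /near_ratio_sym.
  apply: le_trans (_ : ((A ^+ n)`_l + eps) * expR (- t) <= _); last first.
    by rewrite expRN ler_pdivrMr ?expR_gt0 // mulrC.
  apply: ler_pM.
  - by apply: divr_ge0; [exact: ltW|exact/exprn_ge0/ltW].
  - exact: expR_ge0.
  - by apply: le_trans hl _; rewrite lerDl ltW.
  by rewrite ler_expR lerN2.
have epsle : eps * D <= (A ^+ n)`_m + eps.
  apply: le_trans low.
  rewrite [c1 / _ * _]mulrAC ler_pdivlMr ?exprn_gt0 // expRN ler_pdivlMr ?expR_gt0 //.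
  rewrite /eps expRN.
  have -> : D ^+ 3 * (expR (D ^+ 2 / 2))^-1 * D * D ^+ 8 * expR (2 * c * C1 * D) =
     D ^+ 12 * expR (2 * c * C1 * D) / expR (D ^+ 2 / 2).
    by field; rewrite gt_eqF ?expR_gt0.
  rewrite ler_pdivrMr ?expR_gt0 //.
  have De : D <= expR D by have := expR_ge1Dx D; lra.
  have D12 : D ^+ 12 <= expR (12 * D).
    by rewrite (expRM_natl 12) lerXn2r ?nnegrE ?expR_ge0 ?(ltW D0).
  have ce : 1 <= c1 * expR (1 / c1 * D).
    rewrite mulrC -ler_pdivrMr //; apply: le_trans (_ : 1 / c1 * D <= _).
      by rewrite ler_peMr //; lra.
    by have := expR_ge1Dx (1 / c1 * D); lra.
  have X0 := expR_ge0 (2 * c * C1 * D).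
  apply: le_trans (ler_wpM2r X0 D12) _.
  rewrite -expRD; set Y := expR _.
  have Y0 : 0 <= Y by apply: expR_ge0.
  apply: le_trans (ler_peMl Y0 ce) _.
  rewrite -[leLHS]mulrA (ler_pM2l c10) -expRD ler_expR expr2.
  have : 0 <= (D - 2 * (12 + 2 * c * C1 + 1 / c1)) * D by rewrite mulr_ge0 //; lra.
  lra.
have epsf : eps <= (A ^+ n)`_m.
  have : eps * 2 <= eps * D by rewrite ler_pM2l.
  lra.
split; first exact: lt_le_trans epsf.
move=> r j rn jm.
have rn' : (r <= n)%N by apply: leq_trans rn; rewrite leq_pmull.
have hn' : D ^+ 8 / 2 <= (n - r)%:R.
  rewrite natrB //.
  have : (2 * r)%:R <= (n%:R : R) by rewrite ler_nat.
  rewrite natrM nD; lra.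
have h := near n r m j rn' hn' jm.
have {h} : near_ratio (2 * c * (r + j)%:R / D ^+ 3) ((A ^+ (n - r))`_(m - j) + eps) ((A ^+ n)`_m + eps).
  apply: near_ratio_le h; rewrite ?addr_ge0 ?(ltW e0) //.
  rewrite natrD (_ : c / D ^+ 3 * _ = c * (r%:R + 2 * j%:R) / D ^+ 3); last by ring.
  rewrite ler_pM2r ?invr_gt0 ?exprn_gt0 //.
  have : 0 <= c * r%:R by rewrite mulr_ge0 // ltW.
  lra.
set t := 2 * c * _ / _ => h.
have t0 : 0 <= t by rewrite !(mulr_ge0, invr_ge0, exprn_ge0) // ltW.
have /(_ (addr_ge0 (f0 _ _) (ltW e0))) := near_ratio_dist t0 _ h.
rewrite opprD addrACA subrr addr0 => /le_trans; apply.
have et : 0 <= expR t - 1 by rewrite subr_ge0; have := expR_ge1Dx t; lra.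
have fe : 0 <= (A ^+ n)`_m - eps by rewrite subr_ge0.
have := mulr_ge0 et fe; lra.
Qed.

(** * Weights with ratio tending to zero *)

Section Superexp.
Variable R : realType.
Implicit Types a u : nat -> R.

Definition superexp a := (forall k, 0 <= a k) /\
  forall e, 0 < e -> exists K, forall k, (K <= k)%N -> a k.+1 <= e * a k.

(** A factor whose ratios are bounded cannot spoil ratios that tend to zero. The bound starts at k =
    1 because powers of k vanish at 0. *)
Lemma superexp_mul a b (C : R) : 0 < C -> (forall k, 0 <= b k) ->
  (forall k, (1 <= k)%N -> b k.+1 <= C * b k) ->
  superexp a -> superexp (fun k => b k * a k).
Proof.
move=> C0 b0 bC [a0 ha]; split=> [k|e e0]; first exact: mulr_ge0.
have [K hK] := ha (e / C) (divr_gt0 e0 C0).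
exists K.+1 => k Kk.
have h1 := hK k (ltnW Kk); have h2 := bC k (leq_ltn_trans (leq0n _) Kk).
apply: le_trans (ler_pM _ _ h2 h1) _ => //.
by rewrite le_eqVlt; apply/orP; left; apply/eqP; field; rewrite gt_eqF.
Qed.

Lemma superexp_shift a : superexp a -> superexp (fun k => a k.+1).
Proof.
move=> [a0 ha]; split=> // e /ha[K hK]; exists K => k Kk.
by apply: hK; apply: leqW.
Qed.

Lemma superexp_pseries_diffs a : superexp a -> superexp (pseries_diffs a).
Proof.
move=> ha; apply: (@superexp_mul _ (fun k => k.+1%:R) 2 _ _ _ (superexp_shift ha)) => //.
by move=> k k1; rewrite -natrM ler_nat; lia.
Qed.

Lemma superexp_geometric a t : 0 < t -> superexp a -> superexp (fun k => a k * t ^+ k).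
Proof.
move=> t0 ha.
rewrite (_ : (fun k => _) = (fun k => t ^+ k * a k)); last first.
  by apply/funext => k; rewrite mulrC.
by apply: (@superexp_mul _ _ t) => // k; rewrite ?exprS // exprn_ge0 // ltW.
Qed.

Lemma superexpZ a c : 0 <= c -> superexp a -> superexp (fun k => c * a k).
Proof.
move=> c0 [a0 ha]; split=> [k|e /ha[K hK]]; first exact: mulr_ge0.
by exists K => k Kk; rewrite mulrCA; apply: ler_wpM2l => //; apply: hK.
Qed.

(** Keeping twice the next term on the left makes the induction close, as u b + 2 u (b + 1) <= 2 u
    b. *)
Lemma sum_halving_le u K b : (forall k, (K <= k)%N -> u k.+1 <= u k / 2) ->
  (K <= b)%N -> \sum_(K <= j < b) u j + 2 * u b <= 2 * u K.
Proof.
move=> hu /subnK <-; elim: (b - K)%N => [|d IH].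
  by rewrite add0n big_geq // add0r.
rewrite addSn big_nat_recr /=; last exact: leq_addl.
have := hu (d + K)%N (leq_addl _ _); lra.
Qed.

Lemma superexp_halving a : superexp a ->
  exists K, forall k, (K <= k)%N -> a k.+1 <= a k / 2.
Proof.
by move=> [_ /(_ 2^-1)[//|K hK]]; exists K => k /hK; rewrite mulrC.
Qed.

Lemma superexp_cvg_series a : superexp a -> cvgn (series a).
Proof.
move=> ha; have a0 := ha.1; have [K hK] := superexp_halving ha.
have nd : nondecreasing_seq (series a).
  by apply/nondecreasing_series => i _ _.
apply: nondecreasing_is_cvgn => //.
exists (series a K + 2 * a K) => _ [n _ <-].
have [Kn|nK] := leqP K n; last first.
  apply: le_trans (_ : series a K <= _); first exact/nd/ltnW.
  by rewrite lerDl mulr_ge0.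
rewrite /series /= (big_cat_nat (n := K)) //= lerD2l.
have := sum_halving_le hK Kn; have := a0 n; lra.
Qed.

Lemma superexp_cvg0 a : superexp a -> a @ \oo --> 0.
Proof. by move=> /superexp_cvg_series /cvg_series_cvg_0. Qed.

Lemma superexp_natX a e : superexp a -> superexp (fun k => k%:R ^+ e * a k).
Proof.
move=> ha; apply: (@superexp_mul _ (fun k => k%:R ^+ e) (2 ^+ e) _ _ _ ha) => //.
move=> k k1 /=; rewrite -exprMn lerXn2r ?nnegrE // ?mulr_ge0 //.
by rewrite -natrM ler_nat; lia.
Qed.

Lemma superexp_ratio a : (forall k, 0 <= a k) ->
  (exists K, forall k, (K <= k)%N -> 0 < a k) ->
  (fun k => a k.+1 / a k) @ \oo --> 0 -> superexp a.
Proof.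
move=> a0 [K hK] ha; split=> // e e0.
have /cvgrPdist_le /(_ _ e0) [K' _ hK'] := ha.
exists (maxn K K') => k; rewrite geq_max => /andP[Kk Kk'].
have := hK' k Kk'; rewrite /= sub0r normrN ger0_norm ?divr_ge0 //.
by rewrite ler_pdivrMr // hK.
Qed.

End Superexp.

(** * Chebyshev's inequality and a coefficient of order 1 / n *)

Section Chebyshev.
Variable R : realType.

Lemma horner1_poly (u : nat -> R) b : (\poly_(i < b) u i).[1] = \sum_(i < b) u i.
Proof. by rewrite horner_poly; apply: eq_bigr => i _; rewrite expr1n mulr1. Qed.

Lemma horner1_deriv (u : nat -> R) b :
  (\poly_(i < b) u i)^`().[1] = \sum_(i < b) i%:R * u i.
Proof.
rewrite poly_def raddf_sum /= horner_sum; apply: eq_bigr => i _.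
by rewrite derivZ derivXn hornerZ hornerMn hornerXn expr1n mulrC.
Qed.

Lemma horner1_deriv2 (u : nat -> R) b :
  (\poly_(i < b) u i)^`()^`().[1] = \sum_(i < b) (i%:R * (i%:R - 1)) * u i.
Proof.
rewrite poly_def !raddf_sum /= horner_sum; apply: eq_bigr => i _.
rewrite !(derivZ, derivMn, derivXn) hornerZ !hornerMn hornerXn expr1n mulrC.
case: (nat_of_ord i) => [|j] /=; first by rewrite mulr0n !mul0r.
by rewrite -mulrnA mulnC natrM -[j.+1%:R]natr1 addrK.
Qed.

Lemma second_moment_poly (p : {poly R}) (b : nat) (x : R) : (size p <= b)%N ->
  \sum_(i < b) p`_i * (i%:R - x) ^+ 2 =
  p^`()^`().[1] + p^`().[1] - 2 * x * p^`().[1] + x ^+ 2 * p.[1].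
Proof.
move=> pb; have e : p = \poly_(i < b) p`_i.
  apply/polyP => i; rewrite coef_poly; case: ltnP => // bi.
  by rewrite nth_default // (leq_trans pb).
rewrite [in RHS]e horner1_deriv2 horner1_deriv horner1_poly !mulr_sumr -!big_split /= -sumrN -!big_split /=.
by apply: eq_bigr => i _; ring.
Qed.

Variables (pi : nat -> R) (lam V : R).
Hypothesis pi0 : forall k, 0 <= pi k.
Hypothesis pi1 : series pi @ \oo --> (1 : R).
Hypothesis pilam : series (fun k => k%:R * pi k) @ \oo --> lam.
Hypothesis pi2 : forall n, series (fun k => k%:R * (k%:R - 1) * pi k) n <= V.
Hypothesis lam0 : 0 < lam.
Hypothesis V0 : 0 <= V.

Definition gen_poly L : {poly R} := \poly_(k < L) pi k.
Let A := gen_poly.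

Lemma ge0p_gen_poly L : ge0p (A L).
Proof. by move=> i; rewrite coef_poly; case: ifP. Qed.

Lemma gen_poly_le1 L : (A L).[1] <= 1.
Proof.
rewrite horner1_poly -(big_mkord xpredT pi).
have nd : nondecreasing_seq (series pi) by apply/nondecreasing_series => i _ _.
rewrite -(cvg_lim _ pi1) //; apply: nondecreasing_cvgn_le => //.
by apply: cvgP pi1.
Qed.

(** With n fixed, let the truncation degree L grow: mass and mean of the truncated law tend to 1 and
    lam, so the part [E] of the second moment built from them tends to n (lam - lam^2), while the
    second factorial moment of a single box adds at most n V. The summand 1 in the bound is the
    slack for a finite L. *)
Lemma second_moment_power n B : (0 < n)%N -> exists L, [/\ (B <= L)%N,
  3 / 4 <= (A L ^+ n).[1] &
  forall b, (size (A L ^+ n) <= b)%N ->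
    \sum_(i < b) (A L ^+ n)`_i * (i%:R - lam * n%:R) ^+ 2 <= (V + lam + 1) * n%:R].
Proof.
move=> n0.
pose al L := series pi L; pose mu L := series (fun k => k%:R * pi k) L.
pose x := lam * n%:R.
pose E L := n%:R * (n.-1%:R * (al L ^+ n.-2 * mu L) * mu L) + n%:R * (al L ^+ n.-1 * mu L)
     - 2 * x * (n%:R * (al L ^+ n.-1 * mu L)) + x ^+ 2 * al L ^+ n.
pose lim := n%:R * (n.-1%:R * (1 ^+ n.-2 * lam) * lam) + n%:R * (1 ^+ n.-1 * lam)
     - 2 * x * (n%:R * (1 ^+ n.-1 * lam)) + x ^+ 2 * 1 ^+ n.
have hal k : (fun L => al L ^+ k) @ \oo --> (1 ^+ k : R).
  elim: k => [|k IH]; first exact: cvg_cst.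
  rewrite exprS; rewrite (_ : (fun L => _) = (fun L => al L * al L ^+ k)).
    exact: cvgM.
  by apply/funext => L; rewrite exprS.
have hE : E @ \oo --> lim.
  have cM (u v : nat -> R) (a b : R) : u @ \oo --> a -> v @ \oo --> b ->
    (fun k => u k * v k) @ \oo --> a * b by apply: cvgM.
  have cD (u v : nat -> R) (a b : R) : u @ \oo --> a -> v @ \oo --> b ->
    (fun k => u k + v k) @ \oo --> a + b by apply: cvgD.
  have cC (a : R) : (fun _ : nat => a) @ \oo --> a by apply: cvg_cst.
  rewrite /E /lim; apply: (cD); last by apply: (cM).
  apply: (cD); last by apply: cvgN; apply: (cM) => //; apply: (cM) => //; apply: (cM).
  apply: (cD); last by apply: (cM) => //; apply: (cM).
  by apply: (cM) => //; apply: (cM) => //; apply: (cM) => //; apply: (cM).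
have limE : lim <= lam * n%:R.
  rewrite /lim /x !expr1n !mul1r -subn1 natrB //.
  have : 0 <= n%:R * lam ^+ 2 by rewrite mulr_ge0 ?sqr_ge0.
  lra.
have e1 : lim < lam * n%:R + 1 by lra.
have e2 : 3 / 4 < 1 ^+ n :> R by rewrite expr1n; lra.
near \oo => L.
have EL : E L <= lam * n%:R + 1.
  by apply/ltW; near: L; exact: (cvgr_lt lim hE _ e1).
have aL : 3 / 4 <= al L ^+ n.
  by apply/ltW; near: L; exact: (cvgr_gt _ (hal n) _ e2).
have hA1 : (A L).[1] = al L by rewrite horner1_poly -(big_mkord xpredT pi).
have hA2 : (A L)^`().[1] = mu L.
  by rewrite horner1_deriv -(big_mkord xpredT (fun k => k%:R * pi k)).
have hA3 : (A L)^`()^`().[1] <= V.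
  rewrite horner1_deriv2 -(big_mkord xpredT (fun k => (k%:R * (k%:R - 1)) * pi k)).
  exact: pi2.
have n1 : 1 <= n%:R :> R by rewrite ler1n.
exists L; split; first by near: L; exists B.
  by rewrite horner_exp hA1.
move=> b hb; rewrite second_moment_poly // deriv_exp.
rewrite derivMn derivM deriv_exp.
rewrite !(hornerMn, hornerD, hornerM, horner_exp) hA1 hA2.
set nu := (A L)^`()^`().[1] in hA3 *.
rewrite -/x.
have al1 : al L ^+ n.-1 <= 1.
  rewrite exprn_ile1 // -hA1 ?gen_poly_le1 // horner1_poly.
  by apply: sumr_ge0.
have al0 : 0 <= al L ^+ n.-1.
  by rewrite exprn_ge0 // -hA1 horner1_poly; apply: sumr_ge0.
have nu0 : 0 <= nu.
  rewrite /nu horner1_deriv2 sumr_ge0 // => i _; rewrite mulr_ge0 //.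
  case: (nat_of_ord i) => [|j]; first by rewrite mul0r.
  by rewrite mulr_ge0 // subr_ge0 ler1n.
have h : n%:R * (al L ^+ n.-1 * nu) <= n%:R * V.
  by rewrite ler_wpM2l // (le_trans _ hA3) // ler_piMl.
apply: le_trans (_ : E L + n%:R * (al L ^+ n.-1 * nu) <= _).
  by rewrite le_eqVlt; apply/orP; left; apply/eqP; rewrite /E; ring.
apply: le_trans (lerD EL h) _.
nra.
Unshelve. all: by end_near.
Qed.

(** If all coefficients within C1 sqrt n of lam n were below c1 / n, they would carry at most 1/4 of
    the mass, and Chebyshev's inequality leaves at most 1/4 outside, against a total of at least
    3/4. Counting all indices up to (lam + C1) n instead of the O(sqrt n) in the window is crude but
    sufficient. *)
Lemma large_coef : exists C1 c1 : R, [/\ 0 < C1, 0 < c1 &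
  forall n B, (0 < n)%N -> exists L l, [/\ (B <= L)%N,
    `|l%:R - lam * n%:R| <= C1 * Num.sqrt n%:R &
     c1 / n%:R <= (A L ^+ n)`_l]].
Proof.
pose W := V + lam + 1; have W0 : 0 < W by rewrite /W; have := V0; have := lam0; lra.
(* This C1 makes Chebyshev's bound W n / (C1^2 n) equal to 1/4; C2 n will bound the number b of
   indices up to (lam + C1) n. *)
pose C1 := Num.sqrt (4 * W).
have C12 : C1 ^+ 2 = 4 * W by rewrite sqr_sqrtr //; lra.
have C10 : 0 < C1 by rewrite sqrtr_gt0; lra.
pose C2 := lam + C1 + 1; have C20 : 0 < C2 by rewrite /C2; have := lam0; lra.
exists C1, (4 * C2)^-1; split => //; first by rewrite invr_gt0; lra.
move=> n B n0.
have [L [BL h1 h2]] := @second_moment_power n B n0.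
suff [l hl1 hl2] : exists2 l : nat, `|l%:R - lam * n%:R| <= C1 * Num.sqrt n%:R &
     (4 * C2)^-1 / n%:R <= (A L ^+ n)`_l by exists L, l.
apply: contrapT => hcontra.
have small l : `|l%:R - lam * n%:R| <= C1 * Num.sqrt n%:R ->
   (A L ^+ n)`_l <= (4 * C2)^-1 / n%:R.
  move=> hl; rewrite leNgt; apply/negP => hl2; apply: hcontra; exists l => //.
  exact: ltW.
have n1 : 1 <= n%:R :> R by rewrite ler1n.
have nn0 : 0 < n%:R :> R by lra.
pose p := A L ^+ n.
have p0 i : 0 <= p`_i by apply: ge0pX; apply: ge0p_gen_poly.
pose b := (Num.truncn ((lam + C1) * n%:R)).+1.
have lC : 0 <= (lam + C1) * n%:R by rewrite mulr_ge0 //; have := lam0; lra.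
have /andP[b1 b2] := truncn_itv lC.
have bb : b%:R <= C2 * n%:R.
  by rewrite /b -natr1 /C2; lra.
(* Either the index lies in the window and the cap applies, or its squared distance exceeds 4 W n;
   adding both bounds avoids splitting the sum. *)
have key i : p`_i <= (if (i < b)%N then (4 * C2)^-1 / n%:R else 0) +
    p`_i * (i%:R - lam * n%:R) ^+ 2 / (4 * W * n%:R).
  have WN : 0 < 4 * W * n%:R by rewrite !mulr_gt0.
  have [hi|hi] := leP `|i%:R - lam * n%:R| (C1 * Num.sqrt n%:R).
    have -> : (i < b)%N.
      rewrite /b ltnS -(ler_nat R) leNgt; apply/negP => hb.
      have : i%:R <= (lam + C1) * n%:R.
        move: hi; rewrite ler_norml => /andP[_ hi].
        have : Num.sqrt n%:R <= n%:R :> R.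
          rewrite -[leRHS]sqr_sqrtr ?ler0n // expr2 ler_peMl ?sqrtr_ge0 //.
          by rewrite -[leLHS]sqrtr1 ler_wsqrtr.
        rewrite -(ler_pM2l C10); lra.
      move=> hi2.
      have : (i < b)%N by rewrite -(ltr_nat R); apply: le_lt_trans hi2 b2.
      by rewrite /b ltnS -(ler_nat R) leNgt hb.
    apply: le_trans (small i hi) _; rewrite lerDl.
    by apply: divr_ge0; [rewrite mulr_ge0 ?sqr_ge0|exact: ltW].
  rewrite -[leLHS]add0r; apply: lerD.
    by case: ifP => // _; apply: divr_ge0 => //; rewrite invr_ge0; lra.
  rewrite ler_pdivlMr // ler_wpM2l // -C12.
  have -> : C1 ^+ 2 * n%:R = (C1 * Num.sqrt n%:R) ^+ 2.
    by rewrite exprMn [Num.sqrt n%:R ^+ 2]sqr_sqrtr.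
  rewrite -[leRHS]real_normK ?num_real // lerXn2r ?nnegrE ?normr_ge0 //.
    by apply: mulr_ge0; [exact: ltW|exact: sqrtr_ge0].
  exact: ltW.
pose M := maxn (size p) b.
have hM : (size p <= M)%N by apply: leq_maxl.
have hb : (b <= M)%N by apply: leq_maxr.
have pM : p.[1] = \sum_(i < M) p`_i.
  rewrite -[in LHS](coefK p) horner1_poly.
  rewrite (big_ord_widen_cond M xpredT (fun i => p`_i) hM) big_mkcond.
  apply: eq_bigr => i _ /=; case: ltnP => // hi; by rewrite nth_default.
have : p.[1] <= b%:R * ((4 * C2)^-1 / n%:R) + W * n%:R / (4 * W * n%:R).
  rewrite pM; apply: le_trans (ler_sum _ (fun i _ => key (nat_of_ord i))) _.
  rewrite big_split /= -big_mkcond /=.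
  rewrite -(big_ord_widen M (fun _ => (4 * C2)^-1 / n%:R) hb).
  rewrite sumr_const card_ord -[_ *+ b]mulr_natl lerD2l -mulr_suml.
  have WN : 0 < 4 * W * n%:R by rewrite !mulr_gt0.
  by rewrite ler_pM2r ?invr_gt0 //; apply: h2.
have -> : W * n%:R / (4 * W * n%:R) = 1 / 4.
  by field; rewrite !gt_eqF.
have : b%:R * ((4 * C2)^-1 / n%:R) <= 1 / 4.
  rewrite mulrA ler_pdivrMr // ler_pdivrMr; last lra.
  have -> : 1 / 4 * n%:R * (4 * C2) = C2 * n%:R by field.
  exact: bb.
rewrite /p; lra.
Qed.

End Chebyshev.

(** * Moments and the law of the maximum along a sequence *)

Lemma alternating_sum_bin (S : pzRingType) j r :
  \sum_(i < r.+1) (-1) ^+ i * 'C(j.+1, i)%:R = (-1) ^+ r * 'C(j, r)%:R :> S.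
Proof.
elim: r => [|r IH]; first by rewrite big_ord_recr big_ord0 /= !bin0 add0r.
by rewrite big_ord_recr /= IH binS natrD mulrDr exprS mulN1r !mulNr addrCA subrr addr0.
Qed.

(** For j > 0 the alternating sum has absolute value C(j - 1, r - 1), one of the two Pascal summands
    of C(j, r). *)
Lemma bonferroni_pointwise (R : realDomainType) j r : (0 < r)%N ->
  `|(j == 0%N)%:R - \sum_(i < r) (-1) ^+ i * 'C(j, i)%:R| <= 'C(j, r)%:R :> R.
Proof.
case: r => // r _; case: j => [|j].
  rewrite big_ord_recl bin0 expr0 mulr1 big1 ?addr0 ?subrr ?normr0 // => i _.
  by rewrite bin0n mulr0.
rewrite alternating_sum_bin sub0r normrN normrM normrX normrN1 expr1n mul1r.
by rewrite ger0_norm // binS natrD lerDr.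
Qed.

Section RootD.
Variable R : realType.

(* n^(1/8): with s = D^-3 in [step_bound] one has n s^2 = D^2, which beats the
   loss D^4 * O(s) = O(D) in the exponent caused by sqrt n = D^4 steps. *)
Definition rootD (n : nat) : R := Num.sqrt (Num.sqrt (Num.sqrt n%:R)).

Lemma rootD_ge0 n : 0 <= rootD n. Proof. exact: sqrtr_ge0. Qed.

Lemma rootD4 n : rootD n ^+ 4 = Num.sqrt n%:R.
Proof. by rewrite (exprM _ 2 2) !sqr_sqrtr ?sqrtr_ge0. Qed.

Lemma rootD8 n : rootD n ^+ 8 = n%:R.
Proof. by rewrite (exprM _ 4 2) rootD4 sqr_sqrtr. Qed.

Lemma rootD_large (B : R) : \forall n \near \oo, B <= rootD n.
Proof.
pose B' := Num.max B 0; have B'0 : 0 <= B' by rewrite le_max lexx orbT.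
near=> n; apply: le_trans (_ : B' <= _); first by rewrite le_max lexx.
rewrite -(@ler_pXn2r _ 8) ?nnegrE ?rootD_ge0 // rootD8.
apply: le_trans (_ : (Num.truncn (B' ^+ 8)).+1%:R <= _).
  by apply/ltW/truncnS_gt.
rewrite ler_nat; near: n; exact: nbhs_infty_ge.
Unshelve. all: by end_near. Qed.

End RootD.

Section Asymptotics.
Variable R : realType.
Variables (pi : nat -> R) (m L : nat -> nat) (c lam : R) (n0 : nat).
Let A n := gen_poly pi (L n).
Let f n := (A n ^+ n)`_(m n).
Let D := @rootD R.
Hypothesis hsup : superexp pi.
Hypothesis c_gt0 : 0 < c.
Hypothesis lam_gt0 : 0 < lam.
Hypothesis nL : forall n, (n0 <= n)%N -> (n < L n)%N.
Hypothesis mlam : forall n, (n0 <= n)%N -> lam * n%:R <= (m n)%:R.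
Hypothesis f_gt0 : forall n, (n0 <= n)%N -> 0 < f n.
Hypothesis smooth : forall n r j, (n0 <= n)%N -> (2 * r <= n)%N -> (j <= m n)%N ->
  `|(A n ^+ (n - r))`_(m n - j) - f n| <=
     2 * (expR (c * (r + j)%:R / D n ^+ 3) - 1) * f n.

Let pi0 k : 0 <= pi k. Proof. exact: hsup.1. Qed.

(** Union bound over boxes with more than k balls: the difference is at most n times the sum over i
    > k of pi_i f(n - 1, m - i). Smoothness bounds the last factor by 2 E^(i + 1) f(n, m), and pi
    decays so fast that the term i = k + 1 dominates. Two polynomials p and q are allowed because
    both q = A and q = A - pi_k X^k occur. *)
Lemma tail_difference : exists n1 K1, forall n k (p q : {poly R}),
  (n1 <= n)%N -> (K1 <= k)%N -> k%:R <= D n ^+ 2 ->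
  ge0p p -> ge0p (q - p) -> ge0p (A n - q) ->
  (forall i, (q - p)`_i <= if (k < i)%N then pi i else 0) ->
  (q ^+ n)`_(m n) - (p ^+ n)`_(m n) <= 4 * expR 1 * (n%:R * pi k.+1) * f n.
Proof.
(* Ratios at most 1/4, times E <= 2, give ratios at most 1/2 for pi_i E^i. *)
have [_ /(_ (1/4) ltac:(lra))[K1 hK1]] := hsup.
have [n1 _ hn1] := rootD_large (2 * c + 2).
exists (maxn 2 (maxn n0 n1)), K1 => n k p q.
rewrite !geq_max => /and3P[n2 nn0 nn1] Kk kD hp hqp hAq hi.
have {hn1}hD : 2 * c + 2 <= D n by apply: hn1.
have c0 := c_gt0.
have D0 : 0 < D n by lra.
have D3 : 0 < D n ^+ 3 by rewrite exprn_gt0.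
have hq : ge0p q by rewrite -(subrK p q); apply: ge0pD.
have hA : ge0p (A n) by rewrite -(subrK q (A n)); apply: ge0pD.
set E := expR (c / D n ^+ 3).
have E0 : 0 < E by apply: expR_gt0.
have E2 : E <= 2.
  have h : c / D n ^+ 3 <= 1 / 2.
    rewrite ler_pdivrMr //; apply: le_trans (_ : 1 / 2 * D n <= _); first lra.
    by rewrite ler_pM2l // exprS ler_peMr ?(ltW D0) // exprn_ege1 //; lra.
  have h0 : 0 <= c / D n ^+ 3 by rewrite divr_ge0 // ltW.
  have := @expR_le_quadratic R (c / D n ^+ 3); rewrite ger0_norm // => /(_ h).
  rewrite -/E; nra.
have ratio i : (i <= m n)%N -> (A n ^+ n.-1)`_(m n - i) <= 2 * E ^+ i.+1 * f n.
  move=> im; have := @smooth n 1%N i nn0 n2 im.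
  rewrite subn1 add1n (_ : c * i.+1%:R / _ = i.+1%:R * (c / D n ^+ 3)); last by ring.
  rewrite expRM_natl -/E => h.
  have fn := f_gt0 nn0.
  have := le_trans (ler_norm _) h; lra.
have step1 : (q ^+ n)`_(m n) - (p ^+ n)`_(m n) <=
    n%:R * ((q - p) * A n ^+ n.-1)`_(m n).
  have := @ge0p_expB_le R p q n hp hqp (m n).
  rewrite coefB subr_ge0 coefB => h; apply: le_trans h _.
  rewrite coefMn -[leLHS]mulr_natl ler_wpM2l //.
  rewrite -subr_ge0 -coefB -mulrBr; apply: ge0pM => //.
  exact: ge0p_expB.
apply: le_trans step1 _.
(* The index i runs up to m, where E^i need not be bounded; it is therefore kept together with
   pi_i. *)
pose u i := pi i * E ^+ i.
have hu i : (k < i)%N -> u i.+1 <= u i / 2.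
  move=> ki; rewrite /u exprS.
  have := hK1 i (leq_trans Kk (ltnW ki)) => h.
  have Ei : 0 <= E ^+ i by rewrite exprn_ge0 // ltW.
  have : pi i.+1 * E <= 1 / 4 * pi i * 2.
    by apply: ler_pM => //; rewrite ltW.
  move=> h2; have := ler_wpM2r Ei h2; lra.
have sumle : ((q - p) * A n ^+ n.-1)`_(m n) <= 2 * E * f n * (2 * u k.+1).
  have fn := f_gt0 nn0.
  rewrite coefM.
  apply: (@le_trans _ _ (\sum_(i < (m n).+1) if (k < i)%N then 2 * E * f n * u i else 0)).
    apply: ler_sum => i _.
    have im : (i <= m n)%N by rewrite -ltnS.
    apply: le_trans (ler_wpM2r _ (hi i)) _; first exact: ge0pX.
    case: ifP => _; last by rewrite mul0r.
    apply: le_trans (ler_wpM2l (pi0 i) (ratio i im)) _.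
    by rewrite /u exprS le_eqVlt; apply/orP; left; apply/eqP; ring.
  rewrite -big_mkcond -mulr_sumr ler_wpM2l //.
    by rewrite !mulr_ge0 // ltW.
  have u0 i : 0 <= u i by rewrite mulr_ge0 // exprn_ge0 // ltW.
  have [km|mk] := leqP k.+1 (m n).+1; last first.
    rewrite big1; first by apply: mulr_ge0 => //; apply: u0.
    by move=> i ki; have := leq_trans (ltn_ord i) (ltnW mk); rewrite ltnNge ki.
  rewrite -(big_mkord (fun i => k < i)%N u) (big_cat_nat (n := k.+1)) //=.
  rewrite big_nat_cond big1 ?add0r; last first.
    by move=> i /andP[/andP[_ ik] ki]; rewrite ltnS leqNgt ki in ik.
  have -> : \sum_(k.+1 <= i < (m n).+1 | (k < i)%N) u i = \sum_(k.+1 <= i < (m n).+1) u i.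
    rewrite big_nat_cond [RHS]big_nat_cond; apply: eq_bigl => i.
    by case: ltnP => //=; rewrite andbT.
  have := sum_halving_le hu km.
  have := u0 (m n).+1; lra.
have EK : E ^+ k.+2 <= expR 1.
  rewrite -expRM_natl ler_expR mulrA ler_pdivrMr // mul1r.
  have h1 : (k.+2)%:R * c <= (D n ^+ 2 + 2) * c.
    by rewrite ler_pM2r // -addn2 natrD lerD2r.
  apply: le_trans h1 _; rewrite exprS.
  have DD : 1 <= D n ^+ 2 by rewrite exprn_ege1 //; lra.
  nra.
apply: le_trans (ler_wpM2l (ler0n _ n) sumle) _.
have fn := f_gt0 nn0.
have -> : n%:R * (2 * E * f n * (2 * u k.+1)) = 4 * E ^+ k.+2 * (n%:R * pi k.+1) * f n.
  by rewrite /u [E ^+ k.+2]exprS; ring.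
by rewrite !ler_wpM2r ?mulr_ge0 ?ler_wpM2l // ltW.
Qed.

(** * Moments of the number of boxes with k balls *)

Variables (N kk : nat -> nat).
Hypothesis N_oo : N @ \oo --> \oo.
Hypothesis k_le : \forall j \near \oo, (kk j)%:R <= D (N j) ^+ 2.

(* The r-th binomial moment of the number of boxes with [kk j] balls is
   'C(N j, r) * pi (kk j) ^+ r * rho r j, and H j is the probability that there is
   no such box. *)
Let rho r j := (A (N j) ^+ (N j - r))`_(m (N j) - kk j * r) / f (N j).
Let mu j := (N j)%:R * pi (kk j).
Let H j := ((A (N j) - pi (kk j) *: 'X^(kk j)) ^+ N j)`_(m (N j)) / f (N j).

Lemma near_D (B : R) : \forall j \near \oo, B <= D (N j).
Proof. exact: N_oo (rootD_large B). Qed.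

Lemma near_N (b : nat) : \forall j \near \oo, (b <= N j)%N.
Proof. exact: N_oo (nbhs_infty_ge b). Qed.

(** The total m is at least lam D^8, while r boxes of k balls hold only O(D^2). *)
Lemma near_k_mul r : \forall j \near \oo, (kk j * r <= m (N j))%N.
Proof.
near=> j; rewrite -(ler_nat R) natrM.
have D1 : 1 + r%:R / lam <= D (N j) by near: j; exact: near_D.
have nj : (n0 <= N j)%N by near: j; exact: near_N.
have kj : (kk j)%:R <= D (N j) ^+ 2 by near: j; exact: k_le.
apply: le_trans (mlam nj).
rewrite -(rootD8 R) -/D.
have rl : 0 <= r%:R / lam by rewrite divr_ge0 // ltW.
apply: le_trans (_ : D (N j) ^+ 2 * r%:R <= _); first by rewrite ler_wpM2r.
have -> : lam * D (N j) ^+ 8 = D (N j) ^+ 2 * (lam * D (N j) ^+ 6) by ring.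
rewrite ler_wpM2l ?sqr_ge0 // mulrC -ler_pdivrMr //.
apply: le_trans (_ : D (N j) <= _); first lra.
by rewrite exprS ler_peMr ?exprn_ege1 //; lra.
Unshelve. all: by end_near. Qed.

(** The exponent c (r + k r) / D^3 is O(1 / D) because k <= D^2. *)
Lemma rho_cvg r : rho r @ \oo --> (1 : R).
Proof.
apply/cvgrPdist_le => e e0; near=> j.
have nj : (n0 <= N j)%N by near: j; exact: near_N.
have rj : (2 * r <= N j)%N by near: j; exact: near_N.
have kj : (kk j * r <= m (N j))%N by near: j; exact: near_k_mul.
have kD : (kk j)%:R <= D (N j) ^+ 2 by near: j; exact: k_le.
have D1 : 1 <= D (N j) by near: j; exact: near_D.
have D2 : 4 * c * r%:R <= D (N j) by near: j; exact: near_D.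
have D3 : 8 * c * r%:R / e <= D (N j) by near: j; exact: near_D.
have fj := f_gt0 nj.
rewrite distrC /rho -[1](@divff _ (f (N j))) ?gt_eqF // -mulrBl normrM [`|_^-1|]gtr0_norm ?invr_gt0 //.
rewrite ler_pdivrMr //; apply: le_trans (smooth nj rj kj) _.
rewrite ler_pM2r //.
set t := c * _ / _.
have D0 : 0 < D (N j) by lra.
have DD : 1 <= D (N j) ^+ 2 by rewrite exprn_ege1.
have c0 : 0 <= c := ltW c_gt0.
have ht : t <= 2 * c * r%:R / D (N j).
  rewrite /t ler_pdivrMr ?exprn_gt0 //.
  have -> : 2 * c * r%:R / D (N j) * D (N j) ^+ 3 = c * (r%:R * (2 * D (N j) ^+ 2)).
    by field; rewrite gt_eqF.
  rewrite ler_wpM2l // natrD natrM -{1}[r%:R]mulr1 [_ * r%:R]mulrC -mulrDr ler_wpM2l //.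
  lra.
have t0 : 0 <= t.
  by apply: divr_ge0; [apply: mulr_ge0|apply/exprn_ge0/ltW].
have t1 : t <= 1 / 2.
  apply: le_trans ht _; rewrite ler_pdivrMr //; lra.
have te : 4 * t <= e.
  have : 2 * c * r%:R / D (N j) <= e / 4.
    rewrite ler_pdivrMr //.
    move: D3; rewrite ler_pdivrMr //; lra.
  lra.
have := @expR_le_quadratic R t; rewrite ger0_norm // => /(_ t1).
nra.
Unshelve. all: by end_near. Qed.

Lemma occ_moment r j : (n0 <= N j)%N -> (kk j * r <= m (N j))%N ->
  \sum_(i < (N j).+1) occ (A (N j)) (pi (kk j)) (kk j) (N j) (m (N j)) i *+ 'C(i, r) =
  pi (kk j) ^+ r *+ 'C(N j, r) * rho r j * f (N j).
Proof.
move=> nj kj; rewrite sum_occ_bin coefXnM ltnNge kj /= /rho -!mulrA mulVf ?mulr1 //.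
by rewrite gt_eqF ?f_gt0.
Qed.

Lemma k_lt_L n k : (n0 <= n)%N -> k%:R <= D n ^+ 2 -> 1 <= D n -> (k < L n)%N.
Proof.
move=> nn kD D1; apply: leq_ltn_trans (nL nn).
rewrite -(ler_nat R) -(rootD8 R n) -/D; apply: le_trans kD _.
by rewrite ler_weXn2l.
Qed.

Lemma ge0p_sub_pik n k : (n0 <= n)%N -> k%:R <= D n ^+ 2 -> 1 <= D n ->
  ge0p (A n - pi k *: 'X^k).
Proof.
move=> nn kD D1; have kL := k_lt_L nn kD D1.
move=> i; rewrite coefB coefZ coefXn coef_poly.
case: eqP => [->|_]; first by rewrite kL mulr1 subrr.
by rewrite mulr0 subr0; case: ifP.
Qed.

Lemma near_occ_ge0 : \forall j \near \oo, forall i,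
  0 <= occ (A (N j)) (pi (kk j)) (kk j) (N j) (m (N j)) i.
Proof.
near=> j => i; apply: occ_ge0 => //; apply: ge0p_sub_pik.
- by near: j; exact: near_N.
- by near: j; exact: k_le.
- by near: j; exact: near_D.
Unshelve. all: by end_near. Qed.

(** Second moment method: the indicator of i = 0 is at most (i / mu - 1)^2, whose expectation is at
    most rho_2 + rho_1 / mu - 2 rho_1 + 1, and this tends to 0. *)
Lemma H_cvg0 : mu @ \oo --> +oo -> H @ \oo --> (0 : R).
Proof.
move=> muy.
have mu0 : \forall j \near \oo, 0 < mu j by move/cvgryPgt: muy => /(_ 0).
have imu : (fun j => (mu j)^-1) @ \oo --> (0 : R) by apply/(gtr0_cvgV0 mu0).
apply: (@squeeze_cvgr _ _ _ _ (fun _ => 0) (fun j => rho 2 j + rho 1 j * (mu j)^-1 - 2 * rho 1 j + 1)).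
- near=> j.
  have nj : (n0 <= N j)%N by near: j; exact: near_N.
  have fj := f_gt0 nj.
  have mj : 0 < mu j by near: j.
  have q0 : forall i, 0 <= occ (A (N j)) (pi (kk j)) (kk j) (N j) (m (N j)) i.
    by near: j; exact: near_occ_ge0.
  have k1 : (kk j * 1 <= m (N j))%N by near: j; exact: near_k_mul.
  have k2 : (kk j * 2 <= m (N j))%N by near: j; exact: near_k_mul.
  have k0 : (kk j * 0 <= m (N j))%N by rewrite muln0.
  have := occ_moment nj k0; have := occ_moment nj k1; have := occ_moment nj k2.
  set q := occ _ _ _ _ _ in q0 *.
  have e0 : \sum_(i < (N j).+1) q i = f (N j) by apply: sum_occ.
  move=> e2 e1 _.
  rewrite /H -occ0 -/q divr_ge0 ?(ltW fj) //=.
  rewrite ler_pdivrMr //.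
  apply: (@le_trans _ _ (\sum_(i < (N j).+1) q i * (i%:R / mu j - 1) ^+ 2)).
    rewrite big_ord_recl /= mul0r sub0r sqrrN expr1n mulr1 lerDl.
    by apply: sumr_ge0 => i _; rewrite mulr_ge0 ?sqr_ge0.
  have -> : \sum_(i < (N j).+1) q i * (i%:R / mu j - 1) ^+ 2 =
      2 / mu j ^+ 2 * (\sum_(i < (N j).+1) q i *+ 'C(i, 2)) +
      ((mu j)^-1 ^+ 2 - 2 * (mu j)^-1) * (\sum_(i < (N j).+1) q i *+ 'C(i, 1)) +
      \sum_(i < (N j).+1) q i.
    rewrite !mulr_sumr -!big_split /=; apply: eq_bigr => i _.
    have hi : (nat_of_ord i)%:R * ((nat_of_ord i)%:R - 1) = 2 * 'C(i, 2)%:R :> R.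
      case: (nat_of_ord i) => [|l]; first by rewrite mul0r bin0n mulr0.
      have := mul_bin_diag l.+1 1; rewrite bin1 /= => /(congr1 (fun n => n%:R : R)).
      by rewrite !natrM -[l.+1%:R]natr1 addrK.
    rewrite bin1 -[q i *+ 'C(i, 2)]mulr_natr -[q i *+ i]mulr_natr.
    have -> : 2 / mu j ^+ 2 * (q i * 'C(i, 2)%:R) = (mu j)^-1 ^+ 2 * q i * (2 * 'C(i, 2)%:R).
      by rewrite exprVn; ring.
    by rewrite -hi; ring.
  rewrite e0 e1 e2 bin1 -[pi _ ^+ 1 *+ _]mulr_natr -[pi _ ^+ 2 *+ _]mulr_natr expr1.
  rewrite [rho 2 j + _ - _ + _]addrC.
  have -> : ((mu j)^-1 ^+ 2 - 2 * (mu j)^-1) * (pi (kk j) * (N j)%:R * rho 1 j * f (N j)) =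
     ((mu j)^-1 - 2) * rho 1 j * f (N j).
    rewrite [pi (kk j) * (N j)%:R]mulrC -/(mu j); field; by rewrite gt_eqF.
  have r2 : 0 <= rho 2 j.
    rewrite /rho; apply: divr_ge0; last exact: ltW.
    apply: ge0pX; exact: ge0p_gen_poly.
  have : 2 / mu j ^+ 2 * (pi (kk j) ^+ 2 * 'C(N j, 2)%:R * rho 2 j * f (N j)) <= rho 2 j * f (N j).
    have cc : 2 / mu j ^+ 2 * (pi (kk j) ^+ 2 * 'C(N j, 2)%:R) <= 1.
      rewrite mulrAC ler_pdivrMr ?exprn_gt0 // mul1r.
      have := mul_bin_diag (N j) 1; rewrite bin1 => /(congr1 (fun n => n%:R : R)).
      rewrite !natrM mulrCA => <-; rewrite /mu exprMn mulrC ler_wpM2r ?sqr_ge0 //.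
      by rewrite expr2 ler_wpM2l // ler_nat leq_pred.
    have rf : 0 <= rho 2 j * f (N j) by rewrite mulr_ge0 // ltW.
    apply: le_trans (ler_piMl rf cc).
    by rewrite le_eqVlt; apply/orP; left; apply/eqP; ring.
  lra.
- exact: cvg_cst.
have -> : 0 = 1 + 1 * 0 - 2 * 1 + 1 :> R by ring.
apply: cvgD; last exact: cvg_cst.
apply: cvgB; last by apply: cvgM; [exact: cvg_cst|exact: rho_cvg].
apply: cvgD; first exact: rho_cvg.
by apply: cvgM => //; exact: rho_cvg.
Unshelve. all: by end_near. Qed.


(** Induction on r: as (r + 1) C(N, r + 1) = (N - r) C(N, r), successive terms differ by the factor
    (mu - r pi_k) / (r + 1), and pi_k = mu / N tends to 0. *)
Lemma bin_power_cvg (x : R) r : mu @ \oo --> x ->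
  (fun j => pi (kk j) ^+ r *+ 'C(N j, r)) @ \oo --> x ^+ r / r`!%:R.
Proof.
move=> mux.
have Ny : (fun j => (N j)%:R : R) @ \oo --> +oo by apply/cvgrnyP.
have iN : (fun j => ((N j)%:R : R)^-1) @ \oo --> (0 : R).
  by apply/gtr0_cvgV0 => //; near=> j; rewrite ltr0n; near: j; exact: near_N.
have pik0 : (fun j => pi (kk j)) @ \oo --> (0 : R).
  have lim0 : (fun j => mu j * (N j)%:R^-1) @ \oo --> (0 : R).
    by rewrite -(mulr0 x); apply: cvgM.
  apply: (cvg_trans _ lim0); apply: near_eq_cvg; near=> j.
  rewrite /mu mulrAC divff ?mul1r //.
  by rewrite pnatr_eq0 -lt0n; near: j; exact: near_N.
elim: r => [|r IH].
  rewrite expr0 fact0 divr1.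
  have lim0 : (fun _ : nat => 1 : R) @ \oo --> (1 : R) by exact: cvg_cst.
  apply: (cvg_trans _ lim0).
  by apply: near_eq_cvg; near=> j; rewrite bin0 expr0.
have lim : (fun j => pi (kk j) ^+ r *+ 'C(N j, r) * ((mu j - r%:R * pi (kk j)) * r.+1%:R^-1)) @ \oo -->
    x ^+ r / r`!%:R * ((x - r%:R * 0) * r.+1%:R^-1).
  apply: cvgM => //; apply: cvgM; last exact: cvg_cst.
  by apply: cvgB => //; apply: cvgM => //; exact: cvg_cst.
have -> : x ^+ r.+1 / (r.+1)`!%:R = x ^+ r / r`!%:R * ((x - r%:R * 0) * r.+1%:R^-1).
  rewrite factS natrM exprS; field.
  by rewrite nat1r !pnatr_eq0 /= -lt0n fact_gt0.
apply: (cvg_trans _ lim); apply: near_eq_cvg; near=> j.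
have rN : (r <= N j)%N by near: j; exact: near_N.
rewrite -[_ *+ _]mulr_natr -[in RHS]mulr_natr /mu.
have : r.+1%:R * 'C(N j, r.+1)%:R = ((N j)%:R - r%:R) * 'C(N j, r)%:R :> R.
  by rewrite -natrB // -!natrM mul_bin_left.
have r0 : r.+1%:R != 0 :> R by rewrite pnatr_eq0.
move=> h; apply: (mulfI r0); rewrite exprS.
transitivity (pi (kk j) ^+ r * pi (kk j) * (((N j)%:R - r%:R) * 'C(N j, r)%:R)).
  by field.
by rewrite -h; ring.
Unshelve. all: by end_near. Qed.

(* Bonferroni's inequalities turn the convergence of the factorial moments of the
   number of boxes with k balls into convergence of the probability of no such box. *)
Lemma H_cvg_expR (x : R) : mu @ \oo --> x -> H @ \oo --> expR (- x).
Proof.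
move=> mux.
pose b r j := pi (kk j) ^+ r *+ 'C(N j, r) * rho r j.
have bcvg r : b r @ \oo --> x ^+ r / r`!%:R.
  by rewrite -[_ / _]mulr1; apply: cvgM; [exact: bin_power_cvg|exact: rho_cvg].
have Scvg r : (fun j => \sum_(i < r) (-1) ^+ i * b i j) @ \oo -->
    \sum_(i < r) (-1) ^+ i * (x ^+ i / i`!%:R).
  elim: r => [|r IH].
    rewrite big_ord0.
    have lim0 : (fun _ : nat => 0 : R) @ \oo --> (0 : R) by exact: cvg_cst.
    apply: (cvg_trans _ lim0).
    by apply: near_eq_cvg; near=> j; rewrite big_ord0.
  rewrite big_ord_recr /=.
  have lim : (fun j => \sum_(i < r) (-1) ^+ i * b i j + (-1) ^+ r * b r j) @ \oo -->
      \sum_(i < r) (-1) ^+ i * (x ^+ i / i`!%:R) + (-1) ^+ r * (x ^+ r / r`!%:R).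
    by apply: cvgD => //; apply: cvgM => //; exact: cvg_cst.
  apply: (cvg_trans _ lim).
  by apply: near_eq_cvg; near=> j; rewrite big_ord_recr.
apply/cvgrPdist_le => e e0.
have e4 : 0 < e / 4 by rewrite divr_gt0.
(* The order r is fixed before j. Truncating the exponential series, replacing moments by their
   limits, and the two parts of the Bonferroni remainder [b r j] cost e / 4 each. *)
near \oo => r.
have r0 : (0 < r)%N by near: r; exact: nbhs_infty_gt.
have h1 : `|expR (- x) - \sum_(i < r) (-1) ^+ i * (x ^+ i / i`!%:R)| <= e / 4.
  have -> : \sum_(i < r) (-1) ^+ i * (x ^+ i / i`!%:R) = series (exp_coeff (- x)) r.
    rewrite /series /= big_mkord; apply: eq_bigr => i _.
    by rewrite /exp_coeff /= mulrA [(- x) ^+ _]exprNn.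
  near: r; have /cvgrPdist_le := is_cvg_series_exp_coeff (- x).
  exact.
have h2 : x ^+ r / r`!%:R <= e / 4.
  have : `|0 - x ^+ r / r`!%:R| <= e / 4.
    near: r; have /cvgrPdist_le := cvg_exp_coeff x; exact.
  by rewrite sub0r normrN => /(le_trans (ler_norm _)).
near=> j.
have nj : (n0 <= N j)%N by near: j; exact: near_N.
have fj := f_gt0 nj.
have q0 : forall i, 0 <= occ (A (N j)) (pi (kk j)) (kk j) (N j) (m (N j)) i.
  by near: j; exact: near_occ_ge0.
have kr : (kk j * r <= m (N j))%N by near: j; exact: near_k_mul.
have h3 : `|\sum_(i < r) (-1) ^+ i * (x ^+ i / i`!%:R) - \sum_(i < r) (-1) ^+ i * b i j| <= e / 4.
  by near: j; have /cvgrPdist_le := Scvg r; exact.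
have h4 : `|x ^+ r / r`!%:R - b r j| <= e / 4.
  by near: j; have /cvgrPdist_le := bcvg r; exact.
have h5 : `|H j - \sum_(i < r) (-1) ^+ i * b i j| <= b r j.
  rewrite -(ler_pM2r fj) -{1}(gtr0_norm fj) -normrM mulrBl.
  rewrite /H mulfVK ?gt_eqF // -occ0.
  have := @occ_moment r j nj kr; rewrite -/(b r j).
  have : \sum_(i < r) (-1) ^+ i * b i j * f (N j) = \sum_(i < r) (-1) ^+ i *
     \sum_(l < (N j).+1) occ (A (N j)) (pi (kk j)) (kk j) (N j) (m (N j)) l *+ 'C(l, i).
    apply: eq_bigr => i _; rewrite -mulrA; congr (_ * _).
    rewrite occ_moment //; apply: leq_trans kr.
    by rewrite leq_mul2l (ltnW (ltn_ord i)) orbT.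
  set q := occ _ _ _ _ _ in q0 *.
  rewrite mulr_suml => -> <-.
  under eq_bigr do rewrite mulr_sumr.
  rewrite exchange_big /=.
  have -> : q 0%N = \sum_(l < (N j).+1) q l * (nat_of_ord l == 0%N)%:R.
    rewrite big_ord_recl /= mulr1 big1 ?addr0 // => i _.
    by rewrite mulr0.
  rewrite -sumrB; apply: le_trans (ler_norm_sum _ _ _) _.
  apply: ler_sum => l _.
  have -> : q l * (nat_of_ord l == 0%N)%:R - \sum_(i < r) (-1) ^+ i * (q l *+ 'C(l, i)) =
     q l * ((nat_of_ord l == 0%N)%:R - \sum_(i < r) (-1) ^+ i * 'C(l, i)%:R).
    rewrite mulrBr mulr_sumr; congr (_ - _); apply: eq_bigr => i _.
    by rewrite -[q l *+ _]mulr_natr mulrCA.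
  rewrite normrM ger0_norm // -[leRHS]mulr_natr ler_wpM2l //.
  exact: bonferroni_pointwise.
move: h1 h3 h4 h5; rewrite !ler_norml.
move=> /andP[? ?] /andP[? ?] /andP[? ?] /andP[? ?]; apply/andP; split; lra.
Unshelve. all: by end_near. Qed.


(** * The probability that no box exceeds a threshold *)

Let T k n := gen_poly (fun i => if (i <= k)%N then pi i else 0) (L n).
(* G k n is the probability that no box has more than k balls. *)
Let G k n := (T k n ^+ n)`_(m n) / f n.

Let coefT k n i : (T k n)`_i = if (i < L n)%N && (i <= k)%N then pi i else 0.
Proof. by rewrite coef_poly; case: ifP. Qed.

Let ge0T k n : ge0p (T k n).
Proof. by move=> i; rewrite coefT; case: ifP. Qed.

Lemma G_cvg1 : kk @ \oo --> \oo ->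
  (fun j => (N j)%:R * pi (kk j).+1) @ \oo --> (0 : R) ->
  (fun j => G (kk j) (N j)) @ \oo --> (1 : R).
Proof.
move=> ky tail0; have [n1 [K1 bound]] := tail_difference.
apply: (@squeeze_cvgr _ _ _ _ (fun j => 1 - 4 * expR 1 * ((N j)%:R * pi (kk j).+1)) (fun=> 1)); last exact: cvg_cst.
- near=> j.
  have nj : (n0 <= N j)%N by near: j; exact: near_N.
  have nj1 : (n1 <= N j)%N by near: j; exact: near_N.
  have kK : (K1 <= kk j)%N by near: j; exact: ky (nbhs_infty_ge K1).
  have kD : (kk j)%:R <= D (N j) ^+ 2 by near: j; exact: k_le.
  have fj := f_gt0 nj.
  have coefAT i : (A (N j) - T (kk j) (N j))`_i =
      if (i < L (N j))%N && (kk j < i)%N then pi i else 0.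
    rewrite coefB coefT coef_poly; case: (i < L _)%N; rewrite /= ?subr0 //.
    by case: ltnP; rewrite ?subrr ?subr0.
  have AT : ge0p (A (N j) - T (kk j) (N j)).
    by move=> i; rewrite coefAT; case: ifP.
  have h : f (N j) - (T (kk j) (N j) ^+ N j)`_(m (N j)) <=
      4 * expR 1 * ((N j)%:R * pi (kk j).+1) * f (N j).
    apply: bound => //; first by rewrite subrr => i; rewrite coef0.
    by move=> i; rewrite coefAT; case: (i < L _)%N => //=; case: ifP.
  have := ge0p_expB (N j) (@ge0T _ _) AT (m (N j)); rewrite coefB subr_ge0 => h2.
  apply/andP; split; last by rewrite /G ler_pdivrMr // mul1r.
  rewrite /G ler_pdivlMr //; lra.
- have : (fun j => 1 - 4 * expR 1 * ((N j)%:R * pi (kk j).+1)) @ \oo --> (1 - 4 * expR 1 * 0 : R).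
    by apply: cvgB; [exact: cvg_cst|apply: cvgM => //; exact: cvg_cst].
  by rewrite mulr0 subr0.
Unshelve. all: by end_near. Qed.

Let coefHT n k i : (0 < k)%N -> (k < L n)%N ->
  (A n - pi k *: 'X^k - T k.-1 n)`_i = if (i < L n)%N && (k < i)%N then pi i else 0.
Proof.
move=> k0 kL; rewrite !coefB coefT coef_poly coefZ coefXn.
have [->|ik] := eqVneq i k.
  by rewrite kL ltnn (leqNgt k) prednK // leqnn /= mulr1 subr0 subrr.
rewrite mulr0 subr0; case: (i < L n)%N; rewrite /= ?subr0 //.
by case: (ltngtP i k) ik => // h _; rewrite -ltnS prednK // ?h ?subrr // ltnNge (ltnW h) subr0.
Qed.

(** Having all boxes below k implies having none equal to k: coefficientwise, T at k - 1 is
    dominated by A - pi_k X^k. *)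
Lemma G_pred_le_H : kk @ \oo --> \oo -> \forall j \near \oo,
  0 <= G (kk j).-1 (N j) <= H j.
Proof.
move=> ky; near=> j.
have nj : (n0 <= N j)%N by near: j; exact: near_N.
have k0 : (0 < kk j)%N by near: j; exact: ky (nbhs_infty_gt 0).
have kD : (kk j)%:R <= D (N j) ^+ 2 by near: j; exact: k_le.
have D1 : 1 <= D (N j) by near: j; exact: near_D.
have fj := f_gt0 nj.
have kL := k_lt_L nj kD D1.
rewrite /G divr_ge0 ?(ltW fj) //=; last exact: ge0pX.
rewrite /H ler_pM2r ?invr_gt0 // -subr_ge0 -coefB.
apply: ge0p_expB => // i; rewrite coefHT //; by case: ifP.
Unshelve. all: by end_near. Qed.

(** The events behind G at k - 1 and H differ only by a box with more than k balls, so
    [tail_difference] applies with q = A - pi_k X^k. *)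
Lemma G_pred_cvg (x : R) : kk @ \oo --> \oo ->
  (fun j => (N j)%:R * pi (kk j).+1) @ \oo --> (0 : R) ->
  H @ \oo --> x ->
  (fun j => G (kk j).-1 (N j)) @ \oo --> x.
Proof.
move=> ky tail0 Hx; have [n1 [K1 bound]] := tail_difference.
apply: (@squeeze_cvgr _ _ _ _ (fun j => H j - 4 * expR 1 * ((N j)%:R * pi (kk j).+1)) H) => //.
- near=> j.
  have nj : (n0 <= N j)%N by near: j; exact: near_N.
  have nj1 : (n1 <= N j)%N by near: j; exact: near_N.
  have kK : (K1 <= kk j)%N by near: j; exact: ky (nbhs_infty_ge K1).
  have k0 : (0 < kk j)%N by near: j; exact: ky (nbhs_infty_gt 0).
  have kD : (kk j)%:R <= D (N j) ^+ 2 by near: j; exact: k_le.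
  have D1 : 1 <= D (N j) by near: j; exact: near_D.
  have fj := f_gt0 nj.
  have kL := k_lt_L nj kD D1.
  have /andP[_ GH] : 0 <= G (kk j).-1 (N j) <= H j by near: j; exact: G_pred_le_H.
  rewrite GH andbT.
  have h := bound (N j) (kk j) (T (kk j).-1 (N j)) (A (N j) - pi (kk j) *: 'X^(kk j)) nj1 kK kD (@ge0T _ _).
  rewrite -(ler_pM2r fj) mulrBl /H /G !mulfVK ?gt_eqF //.
  rewrite lerBlDl -lerBlDr; apply: h.
  + by move=> i; rewrite coefHT //; case: ifP.
  + rewrite opprB addrC subrK => i; rewrite coefZ coefXn; case: eqP => _; by rewrite ?mulr1 ?mulr0.
  + by move=> i; rewrite coefHT //; case: (i < L _)%N => //=; case: ifP.
- have : (fun j => H j - 4 * expR 1 * ((N j)%:R * pi (kk j).+1)) @ \oo --> x - 4 * expR 1 * 0.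
    by apply: cvgB => //; apply: cvgM => //; exact: cvg_cst.
  by rewrite mulr0 subr0.
Unshelve. all: by end_near. Qed.

Lemma G_pred_cvg0 : kk @ \oo --> \oo -> mu @ \oo --> +oo ->
  (fun j => G (kk j).-1 (N j)) @ \oo --> (0 : R).
Proof.
move=> ky muy; apply: (@squeeze_cvgr _ _ _ _ (fun=> 0) H); [|exact: cvg_cst|exact: H_cvg0].
exact: G_pred_le_H.
Qed.

End Asymptotics.

(** * Balls in boxes *)

Section Boxes.
Variable R : realType.
Implicit Types u w : nat -> R.

Lemma coef_exp_agree (p q : {poly R}) m n i : (forall j, (j <= m)%N -> p`_j = q`_j) ->
  (i <= m)%N -> (p ^+ n)`_i = (q ^+ n)`_i.
Proof.
move=> pq; elim: n i => [|n IH] i im; first by rewrite !expr0.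
rewrite !exprS !coefM; apply: eq_bigr => l _.
by rewrite pq ?IH //; have := ltn_ord l; lia.
Qed.

Lemma sum_wgt_coef u m n :
  \sum_(y : {ffun 'I_n -> 'I_m.+1} | inB y) wgt u y = (gen_poly u m.+1 ^+ n)`_m.
Proof.
have -> : gen_poly u m.+1 ^+ n = \prod_(i < n) \sum_(k < m.+1) u k *: 'X^k.
  by rewrite prodr_const card_ord /gen_poly poly_def.
rewrite bigA_distr_bigA coef_sum big_mkcond; apply: eq_bigr => y _.
rewrite scaler_prod coefZ prodrXr coefXn /inB eq_sym /wgt.
by case: eqP; rewrite ?mulr1 ?mulr0.
Qed.

Lemma wgt_truncate u m n k (y : {ffun 'I_n -> 'I_m.+1}) :
  wgt (fun i => if (i <= k)%N then u i else 0) y =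
  if (Ymax y <= k)%N then wgt u y else 0.
Proof.
rewrite /wgt /Ymax; case: ifPn => [/bigmax_leqP h|/bigmax_leqP h].
  by apply: eq_bigr => i _; rewrite h.
have [i hi] : exists i, ~~ (y i <= k)%N.
  by apply/existsP; rewrite -negb_forall; apply/negP => /forallP h'; apply: h.
by rewrite (bigD1 i) //= (negbTE hi) mul0r.
Qed.

(** Killing the weights above k encodes the event on the maximum, and any truncation degree L beyond
    m leaves the coefficient at m unchanged. *)
Lemma sum_wgt_le u m n k L : (m < L)%N ->
  \sum_(y : {ffun 'I_n -> 'I_m.+1} | inB y && (Ymax y <= k)%N) wgt u y =
  (gen_poly (fun i => if (i <= k)%N then u i else 0) L ^+ n)`_m.
Proof.
move=> mL; rewrite big_mkcondr /=.
under eq_bigr do rewrite -wgt_truncate.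
rewrite sum_wgt_coef; apply: (@coef_exp_agree _ _ m) => // j jm.
by rewrite !coef_poly ltnS jm (leq_ltn_trans jm mL).
Qed.

Lemma PYmax_coef u m n k L : (m < L)%N -> (0 < k)%N ->
  PYmax u m n k =
  (gen_poly (fun i => if (i <= k)%N then u i else 0) L ^+ n)`_m / (gen_poly u L ^+ n)`_m
  - (gen_poly (fun i => if (i <= k.-1)%N then u i else 0) L ^+ n)`_m / (gen_poly u L ^+ n)`_m.
Proof.
move=> mL k0; rewrite /PYmax -mulr_suml /Zmn sum_wgt_coef -mulrBl.
congr (_ / _); last first.
  by apply: (@coef_exp_agree _ _ m) => // j jm; rewrite !coef_poly ltnS jm (leq_ltn_trans jm mL).
rewrite -!sum_wgt_le // [in RHS](bigID (fun y : {ffun 'I_n -> 'I_m.+1} => (Ymax y <= k.-1)%N)) /=.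
rewrite [X in _ = X + _ - _](_ : _ = \sum_(y : {ffun 'I_n -> 'I_m.+1} | inB y && (Ymax y <= k.-1)%N) wgt u y); last first.
  by apply: eq_bigl => y; case: (inB y) => //=; case: k k0 => // k _ /=; lia.
rewrite addrAC subrr add0r; apply: eq_bigl => y; case: (inB y) => //=.
by case: k k0 => // k _ /=; lia.
Qed.

(** Tilting rescales every configuration of m balls in n boxes by the same tau^m / Phi(tau)^n, which
    cancels against the partition function. *)
Lemma PYmax_pik w tau m n k : tau != 0 -> Phi w tau != 0 ->
  PYmax (pik w tau) m n k = PYmax w m n k.
Proof.
move=> t0 P0; set s := tau ^+ m * ((Phi w tau)^-1 ^+ n).
have s0 : s != 0 by rewrite mulf_neq0 // expf_neq0 // invr_eq0.
have scale (y : {ffun 'I_n -> 'I_m.+1}) : inB y -> wgt (pik w tau) y = s * wgt w y.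
  move=> /eqP hy; rewrite /wgt /pik !big_split /= prodrXr hy prodr_const card_ord /s.
  by rewrite mulrAC.
rewrite /PYmax /Zmn (eq_bigr _ scale) -mulr_sumr.
apply: eq_bigr => y /andP[hy _].
by rewrite scale // -mulf_div divff // mul1r.
Qed.

End Boxes.

(** Here D = n^(1/8), so sqrt n = D^4; m and the index l found by Chebyshev's inequality are both
    O(sqrt n) away from lam n, hence within (C1 + 1) D^4 of each other for large n. *)
Lemma smooth_coef_along (R : realType) (pi : nat -> R) (m : nat -> nat) (lam V : R) (K : nat) :
  (forall k, 0 <= pi k) -> series pi @ \oo --> (1 : R) ->
  series (fun k => k%:R * pi k) @ \oo --> lam ->
  (forall n, series (fun k => k%:R * (k%:R - 1) * pi k) n <= V) ->
  0 < lam -> 0 <= V -> 0 < pi 0%N -> 0 < pi K -> 0 < pi K.+1 ->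
  (fun n : nat => ((m n)%:R - lam * n%:R) / Num.sqrt (n%:R)) @ \oo --> 0 ->
  exists (L : nat -> nat) (c lam' : R) (n0 : nat), [/\ 0 < c, 0 < lam',
    (forall n, (n0 <= n)%N -> (n < L n)%N /\ (m n < L n)%N),
    (forall n, (n0 <= n)%N -> lam' * n%:R <= (m n)%:R) &
    forall n, (n0 <= n)%N -> 0 < (gen_poly pi (L n) ^+ n)`_(m n) /\
     forall r j, (2 * r <= n)%N -> (j <= m n)%N ->
      `|(gen_poly pi (L n) ^+ (n - r))`_(m n - j) - (gen_poly pi (L n) ^+ n)`_(m n)| <=
        2 * (expR (c * (r + j)%:R / rootD R n ^+ 3) - 1) * (gen_poly pi (L n) ^+ n)`_(m n)].
Proof.
move=> pi0 pi1 pilam pi2 lam0 V0 p00 pK pK1 hm.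
have [C1 [c1 [C10 c10 large]]] := large_coef pi0 pi1 pilam pi2 lam0 V0.
pose p0 := Num.min (pi 0%N) (Num.min (pi K) (pi K.+1)).
have p0_gt0 : 0 < p0 by rewrite !lt_min p00 pK pK1.
have C11 : 0 < C1 + 1 by lra.
have [D1 [c [c0 D12 smooth]]] := @coef_power_smooth R K p0 (C1 + 1) c1 p0_gt0 C11 c10.
(* A degree L >= B exceeds n, m and K + 1, so neither the values up to m nor the weights at 0, K, K
   + 1 are cut off. *)
pose B n := (n + m n + K.+2)%N.
have /choice[L hL] n : exists L, (0 < n)%N -> exists l, [/\ (B n <= L)%N,
    `|l%:R - lam * n%:R| <= C1 * Num.sqrt n%:R &
     c1 / n%:R <= (gen_poly pi L ^+ n)`_l].
  have [->|n0] := posnP n; first by exists 0%N.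
  by have [L [l hl]] := large n (B n) n0; exists L => _; exists l.
have /cvgrPdist_le /(_ 1 ltr01) [n1 _ hn1] := hm.
(* The summand 2 / lam gives sqrt n >= 2 / lam, whence m >= lam n - sqrt n >= lam n / 2. *)
have [n2 _ hn2] := rootD_large (D1 + 2 / lam).
exists L, c, (lam / 2), (maxn 1 (maxn n1 n2)).
have hall n : (maxn 1 (maxn n1 n2) <= n)%N -> [/\ (0 < n)%N,
    `|(m n)%:R - lam * n%:R| <= Num.sqrt n%:R & D1 + 2 / lam <= rootD R n].
  rewrite !geq_max => /and3P[n0 nn1 nn2]; split=> //; last exact: hn2.
  have := hn1 n nn1; rewrite /= sub0r normrN normrM.
  have s0 : 0 < Num.sqrt n%:R :> R by rewrite sqrtr_gt0 ltr0n.
  by rewrite [`|_^-1|]gtr0_norm ?invr_gt0 // ler_pdivrMr // mul1r.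
split=> //.
- by rewrite divr_gt0.
- by move=> n /hall[n0 _ _]; have [l [BL _ _]] := hL n n0; move: BL; rewrite /B; clear; lia.
- move=> n /hall[n0 h1 h2]; move: h1; rewrite ler_norml => /andP[h1 _].
  have s0 : 0 <= Num.sqrt n%:R :> R by apply: sqrtr_ge0.
  have il : 0 < 2 / lam by rewrite divr_gt0.
  have hs : Num.sqrt n%:R <= lam / 2 * n%:R.
    rewrite -[X in _ <= _ * X]sqr_sqrtr ?ler0n // expr2 mulrA ler_peMl // ?sqrtr_ge0 //.
    rewrite -ler_pdivrMl ?divr_gt0 // mulr1 invf_div -rootD4.
    apply: le_trans (_ : rootD R n <= _); first lra.
    by rewrite exprS ler_peMr ?rootD_ge0 // exprn_ege1 //; lra.
  lra.
move=> n /hall[n0 h1 h2]; have [l [BL hl1 hl2]] := hL n n0.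
have il : 0 < 2 / lam by rewrite divr_gt0.
apply: (smooth _ (rootD R n) n (m n) l).
- exact: ge0p_gen_poly.
- exact: gen_poly_le1.
- move=> a; rewrite !inE coef_poly => ha.
  have -> : (a < L n)%N.
    apply: leq_trans BL; apply: (@leq_trans K.+2); last exact: leq_addl.
    by case/or3P: ha => /eqP ->; rewrite // ltnS leqnSn.
  by rewrite !ge_min; case/or3P: ha => /eqP ->; rewrite lexx ?orbT.
- lra.
- by rewrite rootD8.
- rewrite rootD4 mulrDl mul1r.
  by apply: le_trans (ler_distD (lam * n%:R) _ _) _; apply: lerD => //; rewrite distrC.
- by rewrite rootD8.
Qed.

(** * The tilted weights *)

(** Indices below B only reach values up to the sum of the first B terms, which [u (k j)] eventually
    exceeds. *)
Lemma index_cvg_infty (R : realType) (u : nat -> R) (k : nat -> nat) :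
  (forall i, 0 <= u i) -> (fun j => u (k j)) @ \oo --> +oo -> k @ \oo --> \oo.
Proof.
move=> u0 uk; apply/cvgnyPge => B; near=> j.
rewrite leqNgt; apply/negP => kB.
have : \sum_(i < B) u i < u (k j).
  by near: j; move/cvgryPgt: uk; exact.
by rewrite (bigD1 (Ordinal kB)) //= ltNge lerDl sumr_ge0.
Unshelve. all: by end_near. Qed.

Section Pik.
Variables (R : realType) (w : nat -> R) (lambda tau : R).
Hypothesis w_ge0 : forall k, 0 <= w k.
Hypothesis w0_gt0 : 0 < w 0%N.
Hypothesis w_sup : superexp w.
Hypothesis tau_gt0 : 0 < tau.
Hypothesis Psi_tau : Psi w tau = lambda.
Let pi := pik w tau.

Let cvg_Phi t : 0 < t -> cvgn (pseries w t).
Proof. by move=> t0; apply: superexp_cvg_series; apply: superexp_geometric. Qed.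

Lemma Phi_gt0 : 0 < Phi w tau.
Proof.
have nd : nondecreasing_seq (pseries w tau).
  apply/nondecreasing_series => i _ _; apply: mulr_ge0 => //.
  by apply: exprn_ge0; apply: ltW.
have := nondecreasing_cvgn_le nd (cvg_Phi tau_gt0) 1%N.
rewrite {1}/pseries /series /= big_nat1 expr0 mulr1.
exact: lt_le_trans.
Qed.

Lemma pik_superexp : superexp pi.
Proof.
rewrite (_ : pi = (fun k => (Phi w tau)^-1 * (w k * tau ^+ k))); last first.
  by apply/funext => k; rewrite /pi /pik mulrC [tau ^+ k * _]mulrC.
apply: superexpZ; first by rewrite invr_ge0 ltW ?Phi_gt0.
exact: superexp_geometric.
Qed.

Lemma pik_sum1 : series pi @ \oo --> (1 : R).
Proof.
have F0 : Phi w tau != 0 by rewrite gt_eqF ?Phi_gt0.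
rewrite (_ : series pi = (fun n => pseries w tau n * (Phi w tau)^-1)).
  rewrite -(divff F0); apply: cvgM; last exact: cvg_cst.
  exact: cvg_Phi.
apply/funext => n; rewrite /pseries /series /= mulr_suml; apply: eq_bigr => k _.
by rewrite /pi /pik [tau ^+ k * _]mulrC.
Qed.

(** Psi(tau) is tau Phi'(tau) / Phi(tau), and termwise differentiation of the power series yields
    the mean. The auxiliary point tau + 1 supplies convergence beyond tau. *)
Lemma pik_mean : series (fun k => k%:R * pi k) @ \oo --> lambda.
Proof.
have t1 : 0 < tau + 1 by have := tau_gt0; lra.
have d1 := superexp_pseries_diffs w_sup.
have d2 := superexp_pseries_diffs d1.
have cv (a : nat -> R) (t : R) : 0 < t -> superexp a -> cvgn (pseries a t).
  by move=> t0 ha; apply: superexp_cvg_series; apply: superexp_geometric.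
have D := @pseries_snd_diffs R w (tau + 1) tau (cv _ _ t1 w_sup) (cv _ _ t1 d1) (cv _ _ t1 d2).
have {}D : is_derive tau (1 : R) (Phi w) (limn (pseries (pseries_diffs w) tau)).
  by apply: D; rewrite !gtr0_norm //; have := tau_gt0; lra.
have e := pseries_diffs_equiv (cv _ _ tau_gt0 d1).
rewrite -Psi_tau /Psi derive1E (derive_val (is_derive := D)).
rewrite (_ : series _ = (fun n => tau * series (fun i => i%:R * w i * tau ^+ i.-1) n * (Phi w tau)^-1)).
  by apply: cvgM; [apply: cvgM => //; exact: cvg_cst|exact: cvg_cst].
apply/funext => n; rewrite /series /= mulr_sumr mulr_suml; apply: eq_bigr => k _.
rewrite /pi /pik; case: k => [|k]; first by rewrite !mul0r mulr0 mul0r.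
by rewrite /= exprS; ring.
Qed.

Lemma pik_second_moment : exists2 V, 0 <= V &
  forall n, series (fun k => k%:R * (k%:R - 1) * pi k) n <= V.
Proof.
have s2 := superexp_natX 2 pik_superexp; have cv := superexp_cvg_series s2.
have p0 k : 0 <= pi k := pik_superexp.1 k.
have nd : nondecreasing_seq (series (fun k => k%:R ^+ 2 * pi k)).
  by apply/nondecreasing_series => i _ _; apply: s2.1.
exists (limn (series (fun k => k%:R ^+ 2 * pi k))).
  have := nondecreasing_cvgn_le nd cv 0%N.
  by rewrite {1}/series /= big_geq.
move=> n; apply: le_trans (nondecreasing_cvgn_le nd cv n).
rewrite /series /=; apply: ler_sum => k _; rewrite ler_wpM2r // expr2.
by rewrite ler_wpM2l // gerBl.
Qed.

(** Rounding 1 / pi_k down loses less than 1, hence less than pi_k after multiplication by pi_k. *)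
Lemma nk_pik_bounds k : 0 < pi k -> 1 - pi k <= nk w tau k * pi k <= 1.
Proof.
move=> p0; rewrite /nk -/(pi k).
have /andP[h1 h2] := floor_itv (1 / pi k).
apply/andP; split; last by rewrite -ler_pdivlMr.
move: h2; rewrite intrD1 ltr_pdivrMr // mulrDl mul1r; lra.
Qed.

Lemma nk_ge0 k : 0 <= nk w tau k.
Proof.
rewrite /nk ler0z floor_ge0 divr_ge0 // -/(pi k); exact: pik_superexp.1.
Qed.

End Pik.

(** * The law of the maximum in the two regimes *)

Unset Implicit Arguments.

Theorem theorem18p23 (R : realType) (w : nat -> R) (lambda tau : R)
  (m : nat -> nat) :
  (forall k, 0 <= w k) ->
  0 < w 0%N ->
  (exists K : nat, forall k, (K <= k)%N -> 0 < w k) ->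
  (fun k => w k.+1 / w k) @ \oo --> 0 ->
  0 < lambda ->
  (fun n : nat => ((m n)%:R - lambda * n%:R) / Num.sqrt (n%:R)) @ \oo --> 0 ->
  0 < tau -> Psi w tau = lambda ->
  (* (i) *)
  (forall (N kk : nat -> nat) (x : R),
      {homo N : a b / (a < b)%N >-> (a < b)%N} ->
      0 < x ->
      (fun j => (N j)%:R / nk w tau (kk j)) @ \oo --> x ->
      (fun j => PYmax w (m (N j)) (N j) (kk j).-1) @ \oo --> expR (- x) /\
      (fun j => PYmax w (m (N j)) (N j) (kk j)) @ \oo --> 1 - expR (- x)) /\
  (* (ii) *)
  (forall (Omega : nat -> R) (N kk : nat -> nat),
      (forall k, 0 < Omega k) ->
      Omega @ \oo --> +oo ->
      (fun j => (N j)%:R : R) @ \oo --> +oo ->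
      (forall j k, (1 <= k)%N ->
         ~ ((Omega k)^-1 * nk w tau k <= (N j)%:R <= Omega k * nk w tau k)) ->
      (forall j, nk w tau (kk j) < (N j)%:R < nk w tau (kk j).+1) ->
      (fun j => PYmax w (m (N j)) (N j) (kk j)) @ \oo --> (1 : R)).
Proof.
move=> w_ge0 w0_gt0 [K w_gt0] w_ratio lam_gt0 hm tau_gt0 hPsi.
have wsup : superexp w by apply: superexp_ratio => //; exists K.
have F_gt0 : 0 < Phi w tau by apply: Phi_gt0.
pose pi := pik w tau.
have pisup : superexp pi by apply: pik_superexp.
have pi_ge0 k : 0 <= pi k := pisup.1 k.
have pi_gt0 k : 0 < w k -> 0 < pi k.
  by move=> wk; rewrite divr_gt0 // mulr_gt0 // exprn_gt0.
have pi_cvg0 : pi @ \oo --> (0 : R) by apply: superexp_cvg0.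
have [V V_ge0 hV] : exists2 V, 0 <= V &
    forall n, series (fun k => k%:R * (k%:R - 1) * pi k) n <= V.
  exact: pik_second_moment.
have [L [c [lam' [n0 [c_gt0 lam'_gt0 hL hml hsm]]]]] :=
  @smooth_coef_along R pi m lambda V K pi_ge0
    (pik_sum1 w_ge0 w0_gt0 wsup tau_gt0) (pik_mean wsup tau_gt0 hPsi)
    hV lam_gt0 V_ge0 (pi_gt0 _ w0_gt0) (pi_gt0 _ (w_gt0 _ (leqnn K)))
    (pi_gt0 _ (w_gt0 _ (leqnSn K))) hm.
have nL n (hn : (n0 <= n)%N) := (hL n hn).1.
have f_gt0 n (hn : (n0 <= n)%N) := (hsm n hn).1.
have smooth n r j (hn : (n0 <= n)%N) := (hsm n hn).2 r j.
pose G k n := (gen_poly (fun i => if (i <= k)%N then pi i else 0) (L n) ^+ n)`_(m n) /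
  (gen_poly pi (L n) ^+ n)`_(m n).
have PG n k : (n0 <= n)%N -> (0 < k)%N -> PYmax w (m n) n k = G k n - G k.-1 n.
  move=> hn k0; have mL := (hL n hn).2.
  rewrite -(@PYmax_pik R w tau) ?gt_eqF //.
  exact: PYmax_coef.
have pi_ratio : (fun k => pi k.+1 / pi k) @ \oo --> (0 : R).
  have lim : (fun k => tau * (w k.+1 / w k)) @ \oo --> tau * 0.
    by apply: cvgM => //; exact: cvg_cst.
  rewrite mulr0 in lim; apply: (cvg_trans _ lim); apply: near_eq_cvg; near=> k.
  have wk : 0 < w k by apply: w_gt0; near: k; exact: nbhs_infty_ge.
  rewrite /pi /pik exprS; field.
  by rewrite !gt_eqF ?exprn_gt0.
(* Since k^4 pi_k tends to 0 while n pi_k >= d, eventually k^4 <= n, that is k <= n^(1/4) = D^2. *)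
have k_le (N k : nat -> nat) (d : R) : 0 < d -> k @ \oo --> \oo ->
    (\forall j \near \oo, d <= (N j)%:R * pi (k j)) ->
    \forall j \near \oo, (k j)%:R <= rootD R (N j) ^+ 2.
  move=> d0 ky hd; near=> j.
  have h : d <= (N j)%:R * pi (k j) by near: j; exact: hd.
  rewrite leNgt; apply/negP => hk.
  have : (k j)%:R ^+ 4 * pi (k j) < d.
    near: j.
    have q0 := superexp_cvg0 (superexp_natX 4 pisup).
    exact: ky (cvgr_lt _ q0 _ d0).
  apply/negP; rewrite -leNgt; apply: le_trans h _; rewrite ler_wpM2r //.
  by rewrite -(rootD8 R) (exprM _ 2 4) lerXn2r ?nnegrE ?sqr_ge0 // ltW.
have nk_pi (k : nat -> nat) : k @ \oo --> \oo ->
    (fun j => nk w tau (k j) * pi (k j)) @ \oo --> (1 : R).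
  move=> ky; apply: (@squeeze_cvgr _ _ _ _ (fun j => 1 - pi (k j)) (fun=> 1)); last exact: cvg_cst.
    near=> j; apply: nk_pik_bounds; apply: pi_gt0; apply: w_gt0.
    by near: j; exact: ky (nbhs_infty_ge K).
  have : (fun j => 1 - pi (k j)) @ \oo --> (1 - 0 : R).
    by apply: cvgB; [exact: cvg_cst|exact: cvg_comp _ _ ky pi_cvg0].
  by rewrite subr0.
have nk0 k : 0 <= nk w tau k by apply: nk_ge0.
split.
  move=> N kk x Nmono x_gt0 hx.
  have Ny : N @ \oo --> \oo.
    apply/cvgnyPge => B; near=> j; apply: (@leq_trans j); first by near: j; exact: nbhs_infty_ge.
    by elim: (j) => // i IH; apply: leq_ltn_trans IH (Nmono _ _ (ltnSn i)).
  have NRy : (fun j => (N j)%:R : R) @ \oo --> +oo by apply/cvgrnyP.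
  (* Division by zero yields 0, so n_k = 0 would make the ratio 0 instead of close to x > 0. *)
  have nk_gt0 : \forall j \near \oo, 0 < nk w tau (kk j).
    near=> j; rewrite lt_neqAle nk0 andbT eq_sym; apply/eqP => e.
    have : 0 < (N j)%:R / nk w tau (kk j) by near: j; exact: (cvgr_gt _ hx _ x_gt0).
    by rewrite e invr0 mulr0 ltxx.
  have nky : (fun j => nk w tau (kk j)) @ \oo --> +oo.
    apply/cvgryPge => B; near=> j.
    have k0 : 0 < nk w tau (kk j) by near: j; exact: nk_gt0.
    have : (N j)%:R / nk w tau (kk j) < x + 1.
      by near: j; apply: (cvgr_lt _ hx); rewrite ltrDl.
    rewrite ltr_pdivrMr // => h.
    have hB : (x + 1) * B <= (N j)%:R by near: j; move/cvgryPge: NRy; exact.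
    have x1 : 0 < x + 1 by rewrite addr_gt0.
    by rewrite -(ler_pM2l x1) ltW // (le_lt_trans hB).
  have kky : kk @ \oo --> \oo by apply: index_cvg_infty nky.
  have mux : (fun j => (N j)%:R * pi (kk j)) @ \oo --> x.
    have lim : (fun j => (N j)%:R / nk w tau (kk j) * (nk w tau (kk j) * pi (kk j))) @ \oo --> x * 1.
      by apply: cvgM => //; exact: nk_pi.
    rewrite mulr1 in lim; apply: (cvg_trans _ lim); apply: near_eq_cvg; near=> j.
    have k0 : 0 < nk w tau (kk j) by near: j; exact: nk_gt0.
    by rewrite mulrA mulfVK ?gt_eqF.
  have x2 : 0 < x / 2 by rewrite divr_gt0.
  have mu_lb : \forall j \near \oo, x / 2 <= (N j)%:R * pi (kk j).
    by near=> j; apply/ltW; near: j; apply: (cvgr_gt _ mux); rewrite ltr_pdivrMr //; lra.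
  have kD := k_le N kk _ x2 kky mu_lb.
  have kk'y : (fun j => (kk j).-1) @ \oo --> \oo.
    apply/cvgnyPge => B; near=> j.
    have : (B < kk j)%N by near: j; exact: kky (nbhs_infty_gt B).
    by case: (kk j).
  have kD' : \forall j \near \oo, ((kk j).-1)%:R <= rootD R (N j) ^+ 2.
    near=> j; apply: le_trans (_ : (kk j)%:R <= _); first by rewrite ler_nat leq_pred.
    by near: j.
  have tail : (fun j => (N j)%:R * pi (kk j).+1) @ \oo --> (0 : R).
    have lim : (fun j => (N j)%:R * pi (kk j) * (pi (kk j).+1 / pi (kk j))) @ \oo --> x * 0.
      by apply: cvgM => //; exact: cvg_comp _ _ kky pi_ratio.
    rewrite mulr0 in lim; apply: (cvg_trans _ lim); apply: near_eq_cvg; near=> j.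
    have p0 : 0 < pi (kk j).
      by apply: pi_gt0; apply: w_gt0; near: j; exact: kky (nbhs_infty_ge K).
    by field; rewrite gt_eqF.
  (* Going from k down to k - 1 multiplies n pi_k, which tends to x, by a ratio tending to infinity;
     boxes with k - 1 balls therefore exist with high probability. *)
  have mu'y : (fun j => (N j)%:R * pi (kk j).-1) @ \oo --> +oo.
    have N0 : \forall j \near \oo, (0 < N j)%N by exact: Ny (nbhs_infty_gt 0).
    have p0 : \forall j \near \oo, 0 < pi (kk j).-1.
      by near=> j; apply: pi_gt0; apply: w_gt0; near: j; exact: kk'y (nbhs_infty_ge K).
    apply/gtr0_cvgV0.
      by near=> j; rewrite mulr_gt0 // ?ltr0n; near: j.
    have lim : (fun j => ((N j)%:R * pi (kk j))^-1 * (pi (kk j).-1.+1 / pi (kk j).-1)) @ \oo --> x^-1 * 0.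
      apply: cvgM; last exact: cvg_comp _ _ kk'y pi_ratio.
      by apply: cvgV => //; rewrite gt_eqF.
    rewrite mulr0 in lim; apply: (cvg_trans _ lim); apply: near_eq_cvg; near=> j.
    have k0 : (0 < kk j)%N by near: j; exact: kky (nbhs_infty_gt 0).
    have q0 : 0 < pi (kk j).
      by apply: pi_gt0; apply: w_gt0; near: j; exact: kky (nbhs_infty_ge K).
    have q1 : 0 < pi (kk j).-1 by near: j.
    have Nj : 0 < (N j)%:R :> R by rewrite ltr0n; near: j.
    by rewrite /= prednK //; field; rewrite !gt_eqF.
  have G1 : (fun j => G (kk j) (N j)) @ \oo --> (1 : R).
    exact: (@G_cvg1 R pi m L c n0 pisup c_gt0 f_gt0 smooth N kk Ny kD kky tail).
  have H1 := @H_cvg_expR R pi m L c lam' n0 pisup c_gt0 lam'_gt0 nL hml f_gt0 smooth N kk Ny kD x mux.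
  have G2 : (fun j => G (kk j).-1 (N j)) @ \oo --> expR (- x).
    exact: (@G_pred_cvg R pi m L c n0 pisup c_gt0 nL f_gt0 smooth N kk Ny kD _ kky tail H1).
  have G3 : (fun j => G (kk j).-2 (N j)) @ \oo --> (0 : R).
    exact: (@G_pred_cvg0 R pi m L c lam' n0 pisup c_gt0 lam'_gt0 nL hml f_gt0 smooth N _ Ny kD' kk'y mu'y).
  split.
    have lim : (fun j => G (kk j).-1 (N j) - G (kk j).-2 (N j)) @ \oo --> expR (- x) - 0.
      exact: cvgB.
    rewrite subr0 in lim.
    apply: (cvg_trans _ lim); apply: near_eq_cvg; near=> j.
    rewrite PG //; first by near: j; exact: Ny (nbhs_infty_ge n0).
    by near: j; exact: kk'y (nbhs_infty_gt 0).
  have lim : (fun j => G (kk j) (N j) - G (kk j).-1 (N j)) @ \oo --> 1 - expR (- x).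
    exact: cvgB.
  apply: (cvg_trans _ lim); apply: near_eq_cvg; near=> j.
  rewrite PG //; first by near: j; exact: Ny (nbhs_infty_ge n0).
  by near: j; exact: kky (nbhs_infty_gt 0).
move=> Omega N kk Om_gt0 Om_y NRy gap between.
have Ny : N @ \oo --> \oo by apply/(@cvgrnyP R).
have kSy : (fun j => (kk j).+1) @ \oo --> \oo.
  apply: (@index_cvg_infty R (nk w tau)) => //.
  apply/cvgryPge => B; near=> j; have /andP[_ h] := between j.
  apply: le_trans (ltW h); near: j; move/cvgryPge: NRy; exact.
have kky : kk @ \oo --> \oo.
  apply/cvgnyPge => B; near=> j; rewrite -ltnS.
  by near: j; exact: kSy (nbhs_infty_gt B).
have Om1 : \forall k \near \oo, 1 <= Omega k by move/cvgryPge: Om_y; exact.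
(* As n > n_k and eventually Omega_k >= 1, n lies above the left end of the excluded interval, so it
   must lie beyond the right end; [klt] is the mirror argument at k + 1. *)
have kgt : \forall j \near \oo, Omega (kk j) * nk w tau (kk j) <= (N j)%:R.
  near=> j; rewrite leNgt; apply/negP => h; have /andP[h1 _] := between j.
  have k1 : (1 <= kk j)%N by near: j; exact: kky (nbhs_infty_ge 1).
  have O1 : 1 <= Omega (kk j) by near: j; exact: kky Om1.
  apply: (gap j (kk j) k1); rewrite (ltW h) andbT; apply: le_trans (ltW h1).
  by rewrite ler_piMl // invf_le1.
have klt : \forall j \near \oo, Omega (kk j).+1 * (N j)%:R <= nk w tau (kk j).+1.
  near=> j; rewrite leNgt; apply/negP => h; have /andP[_ h1] := between j.
  have O1 : 1 <= Omega (kk j).+1 by near: j; exact: kSy Om1.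
  apply: (gap j (kk j).+1) => //; apply/andP; split.
    by rewrite mulrC ler_pdivrMr // mulrC ltW.
  by apply: le_trans (ltW h1) _; rewrite ler_peMl.
(* Eventually n_k pi_k > 1/2, so n pi_k is at least Omega_k / 2; hence the factor 2 in front of
   |B|. *)
have muy : (fun j => (N j)%:R * pi (kk j)) @ \oo --> +oo.
  apply/cvgryPge => B.
  have OB : \forall k \near \oo, 2 * `|B| <= Omega k by move/cvgryPge: Om_y; exact.
  near=> j.
  have h : Omega (kk j) * nk w tau (kk j) <= (N j)%:R by near: j; exact: kgt.
  have hp : 1 / 2 < nk w tau (kk j) * pi (kk j).
    near: j; apply: (cvgr_gt _ (nk_pi kk kky)); lra.
  have hO : 2 * `|B| <= Omega (kk j) by near: j; exact: kky OB.
  apply: le_trans (ler_norm B) _.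
  apply: le_trans (_ : Omega (kk j) * nk w tau (kk j) * pi (kk j) <= _); last by rewrite ler_wpM2r.
  have := Om_gt0 (kk j); rewrite -mulrA; nra.
(* With n_(k+1) pi_(k+1) <= 1, the gap below n_(k+1) becomes n pi_(k+1) <= 1 / Omega_(k+1). *)
have tail : (fun j => (N j)%:R * pi (kk j).+1) @ \oo --> (0 : R).
  have iO : (fun k => (Omega k)^-1) @ \oo --> (0 : R).
    by apply/gtr0_cvgV0 => //; near=> k.
  apply: (@squeeze_cvgr _ _ _ _ (fun=> 0) (fun j => (Omega (kk j).+1)^-1)); [|exact: cvg_cst|exact: cvg_comp _ _ kSy iO].
  near=> j; rewrite mulr_ge0 //=.
  have p0 : 0 < pi (kk j).+1.
    by apply: pi_gt0; apply: w_gt0; near: j; exact: kSy (nbhs_infty_ge K).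
  have h : Omega (kk j).+1 * (N j)%:R <= nk w tau (kk j).+1 by near: j; exact: klt.
  have /andP[_ h1] := nk_pik_bounds p0.
  rewrite -(ler_pM2l (Om_gt0 (kk j).+1)) divff ?gt_eqF // mulrA.
  by apply: le_trans h1; rewrite ler_wpM2r.
have mu1 : \forall j \near \oo, 1 <= (N j)%:R * pi (kk j) by move/cvgryPge: muy; exact.
have kD := k_le N kk _ ltr01 kky mu1.
have G1 : (fun j => G (kk j) (N j)) @ \oo --> (1 : R).
  exact: (@G_cvg1 R pi m L c n0 pisup c_gt0 f_gt0 smooth N kk Ny kD kky tail).
have G2 : (fun j => G (kk j).-1 (N j)) @ \oo --> (0 : R).
  exact: (@G_pred_cvg0 R pi m L c lam' n0 pisup c_gt0 lam'_gt0 nL hml f_gt0 smooth N _ Ny kD kky muy).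
have lim : (fun j => G (kk j) (N j) - G (kk j).-1 (N j)) @ \oo --> (1 - 0 : R).
  exact: cvgB.
rewrite subr0 in lim.
apply: (cvg_trans _ lim); apply: near_eq_cvg; near=> j.
rewrite PG //; first by near: j; exact: Ny (nbhs_infty_ge n0).
by near: j; exact: kky (nbhs_infty_gt 0).
Unshelve. all: by end_near.
Qed.
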